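(* Let $n\ge1$, $T=\{2,\dots,n+1\}$, $S=\{1,n+2,\dots,2n+1\}$, and let $so(2n+1,\mathbb C)$ act on $\mathcal A=\mathbb C[x_1,\dots,x_{2n+1}]$ by the representation attached to $(S,T)$ described in the context. Let $$\Delta=\partial_{x_1}^2-2\sum_{i=1}^nx_{i+1}\partial_{x_{n+i+1}},\qquad\eta=x_1^2+2\sum_{i=1}^nx_{n+i+1}\partial_{x_{i+1}},$$ $\mathcal H_{\langle k\rangle}=\{f\in\mathcal A_{\langle k\rangle}\mid\Delta(f)=0\}$, and for $q\in\mathbb N$ $$f_{1,q}=\sum_{i=0}^q\frac{q!}{i!\,(q-i)!\,(1+2q-2i)!!}\,x_1^{1+2q-2i}x_{n+1}^{q-i}x_{2n+1}^i.$$ Then for every $k\in\mathbb Z$, $\mathcal A_{\langle k\rangle}=\mathcal H_{\langle k\rangle}\oplus\eta\mathcal A_{\langle k-2\rangle}$. Moreover, $\mathcal H_{\langle k\rangle}$ is an irreducible highest weight module with highest weight $(k-1)\lambda_{n-1}-2k\lambda_n$ and a corresponding highest weight vector $f_{1,k-1}$ when $k>0$, and with highest weight $-k\lambda_{n-1}+2(k-1)\lambda_n$ and a corresponding highest weight vector $x_{n+1}^{-k}$ when $k\le0$. Furthermore, the set of polynomials $$\sum_{r_2,\dots,r_{n+1}=0}^\infty\frac{2^{r_2+\cdots+r_{n+1}}\,\epsilon!\,(r_2+\cdots+r_{n+1})!\prod_{i=1}^n\binom{\alpha_{n+i+1}}{r_{i+1}}}{(\epsilon+2\sum_{i=1}^nr_{i+1})!}\,x_1^{\epsilon+2\sum_{i=1}^nr_{i+1}}\prod_{i=1}^nx_{i+1}^{\alpha_{i+1}+r_{i+1}}x_{n+i+1}^{\alpha_{n+i+1}-r_{i+1}},$$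 where $\epsilon\in\{0,1\}$, $\alpha_2,\dots,\alpha_{2n+1}\in\mathbb N$ and $\epsilon+\sum_{i=1}^n(\alpha_{n+i+1}-\alpha_{i+1})=k$, forms a basis of $\mathcal H_{\langle k\rangle}$ ($k\in\mathbb Z$).
   Context: $\mathbb N$ denotes the nonnegative integers; $E_{i,j}$ are matrix units of size $2n+1$; $m!!$ is the double factorial; $\binom ar=0$ for $r>a$. $\mathcal G=so(2n+1,\mathbb C)$ is the span of $E_{i+1,j+1}-E_{n+j+1,n+i+1}$ ($1\le i,j\le n$), $E_{i+1,n+j+1}-E_{j+1,n+i+1}$ and $E_{n+j+1,i+1}-E_{n+i+1,j+1}$ ($1\le i<j\le n$), $E_{i+1,1}-E_{1,n+i+1}$ and $E_{1,i+1}-E_{n+i+1,1}$ ($1\le i\le n$). Cartan subalgebra $H=\sum_{i=1}^n\mathbb C(E_{i+1,i+1}-E_{n+i+1,n+i+1})$; positive root vectors $E_{i+1,j+1}-E_{n+j+1,n+i+1}$, $E_{i+1,n+j+1}-E_{j+1,n+i+1}$ ($1\le i<j\le n$), $E_{i+1,1}-E_{1,n+i+1}$ ($1\le i\le n$), spanning $\mathcal G_+$. With $h_i=E_{i+1,i+1}-E_{n+i+1,n+i+1}-E_{i+2,i+2}+E_{n+i+2,n+i+2}$ ($1\le i\le n-1$), $h_n=2(E_{n+1,n+1}-E_{2n+1,2n+1})$, the fundamental weights satisfy $\lambda_i(h_j)=\delta_{i,j}$; $\lambda_0=0$. The representation attached to a partition $(S,T)$ of $\{1,\dots,2n+1\}$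 is the restriction to $\mathcal G$ of the representation of $gl(2n+1,\mathbb C)$ on $\mathcal A$: $E_{i,j}=x_i\partial_{x_j}$ if $i,j\in S$; $-x_ix_j$ if $i\in S,j\in T$; $\partial_{x_i}\partial_{x_j}$ if $i\in T,j\in S$; $-x_j\partial_{x_i}-\delta_{i,j}$ if $i,j\in T$. $\mathcal A_{\langle k\rangle}=\mathrm{Span}\{x^\alpha\mid\sum_{i\in S}\alpha_i-\sum_{i\in T}\alpha_i=k\}$. The operators $\Delta,\eta$ commute with $\mathcal G$. A highest weight module is one generated by a nonzero $v$ with $H.v\subset\mathbb Cv$ and $\mathcal G_+.v=0$ (a highest weight vector), whose weight is the highest weight. *)

(* Defs.v *)
From mathcomp Require Import all_boot all_order all_algebra.
From mathcomp Require Import complex reals mpoly.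
From mathcomp Require Import zify.

Set Implicit Arguments.
Unset Strict Implicit.
Unset Printing Implicit Defensive.

Import Order.TTheory GRing.Theory Num.Theory.
Local Open Scope ring_scope.

(* The subspaces below are infinite-dimensional, so they are Prop-valued
   predicates rather than elements of a {vspace _}. *)
Section LinearAlgebra.
Variables (C : fieldType) (V : lmodType C).
Implicit Types (P U W M : V -> Prop).

Definition lin_span P (v : V) : Prop :=
  exists s : seq (C * V),
    (forall cu, cu \in s -> P cu.2) /\ v = \sum_(cu <- s) cu.1 *: cu.2.

Definition is_subspace W : Prop :=
  W 0 /\ (forall (c : C) u v, W u -> W v -> W (c *: u + v)).

Definition image_of (f : V -> V) U (v : V) : Prop := exists2 u, U u & v = f u.

Definition direct_sum_of M U W : Prop :=
  (forall v, M v <-> exists u w, [/\ U u, W w & v = u + w]) /\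
  (forall v, U v -> W v -> v = 0).

(* The family (e i), with i ranging over the indices satisfying P, is a basis
   of M. *)
Definition is_basis (I : eqType) (P : I -> Prop) (e : I -> V) M : Prop :=
  (forall (s : seq I) (c : I -> C), uniq s -> (forall i, i \in s -> P i) ->
     \sum_(i <- s) c i *: e i = 0 -> forall i, i \in s -> c i = 0) /\
  (forall v, M v <-> lin_span (fun u => exists2 i, P i & u = e i) v).

(* Modules are subspaces of V stable under the operators act X, for X in a
   set G of elements of a Lie algebra. *)
Variables (L : Type) (act : L -> V -> V) (G : L -> Prop).

Definition is_submodule W : Prop :=
  is_subspace W /\ (forall X v, G X -> W v -> W (act X v)).

Definition is_irreducible M : Prop :=
  [/\ is_submodule M,
      exists2 v, M v & v != 0 &
      forall W, is_submodule W -> (forall v, W v -> M v) ->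
        (forall v, W v -> v = 0) \/ (forall v, M v -> W v)].

Definition is_highest_weight_vector (H Gplus : L -> Prop) (lam : L -> C)
    (v : V) : Prop :=
  [/\ v != 0, forall h, H h -> act h v = lam h *: v &
      forall X, Gplus X -> act X v = 0].

Definition is_highest_weight_module (H Gplus : L -> Prop) M (lam : L -> C)
    (v : V) : Prop :=
  [/\ is_submodule M, M v, is_highest_weight_vector H Gplus lam v &
      forall W, is_submodule W -> W v -> forall u, M u -> W u].

End LinearAlgebra.

Section OscillatorRepresentation.
Variables (C : fieldType) (m : nat) (T : {set 'I_m}).

(* The operator by which E_{i,j} acts on polynomials in m variables, for the
   partition (S, T) of the indices with S the complement of T. *)
Definition gl_unit_act (i j : 'I_m) (f : {mpoly C[m]}) : {mpoly C[m]} :=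
  if i \in T then
    if j \in T then - ('X_j * f^`M(i)) - (i == j)%:R *: f
    else (f^`M(j))^`M(i)
  else
    if j \in T then - ('X_i * 'X_j * f) else 'X_i * f^`M(j).

Definition gl_act (X : 'M[C]_m) (f : {mpoly C[m]}) : {mpoly C[m]} :=
  \sum_(i < m) \sum_(j < m) X i j *: gl_unit_act i j f.

Definition grade (a : 'X_{1..m}) : int :=
  \sum_(i in ~: T) (a i)%:Z - \sum_(i in T) (a i)%:Z.

Definition graded_part (k : int) : {mpoly C[m]} -> Prop :=
  lin_span (fun f => exists2 a : 'X_{1..m}, grade a = k & f = 'X_[a]).

End OscillatorRepresentation.

(* m!! *)
Fixpoint double_fact (m : nat) : nat :=
  if m is m'.+2 then (m * double_fact m')%N else 1%N.

Section OddOrthogonal.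
Variables (C : fieldType) (n : nat).

(* Position of an index p in {1, ..., 2n+1}.  An ordinal i : 'I_n stands for
   the index i + 1 of {1, ..., n}; with i so shifted, x_{i+1} and x_{n+i+1} are
   the variables at ix i.+2 and ix (n + i.+2). *)
Definition ix (p : nat) : 'I_(n.*2.+1) := inord p.-1.

Local Notation poly := {mpoly C[n.*2.+1]}.
Local Notation mat := 'M[C]_(n.*2.+1).
Local Notation x p := ('X_(ix p) : poly).
Local Notation pd p f := (f^`M(ix p)).

Definition E (p q : nat) : mat := delta_mx (ix p) (ix q).

Definition cartan_gen (i : 'I_n) : mat :=
  E i.+2 i.+2 - E (n + i.+2) (n + i.+2).

Definition is_cartan_gen (X : mat) : Prop := exists i, X = cartan_gen i.

Definition is_positive_root_vector (X : mat) : Prop :=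
  [\/ exists i j : 'I_n, (i < j)%N /\ X = E i.+2 j.+2 - E (n + j.+2) (n + i.+2),
      exists i j : 'I_n, (i < j)%N /\ X = E i.+2 (n + j.+2) - E j.+2 (n + i.+2) |
      exists i : 'I_n, X = E i.+2 1 - E 1 (n + i.+2)].

Definition is_so_gen (X : mat) : Prop :=
  [\/ exists i j : 'I_n, X = E i.+2 j.+2 - E (n + j.+2) (n + i.+2),
      exists i j : 'I_n, (i < j)%N /\
        (X = E i.+2 (n + j.+2) - E j.+2 (n + i.+2) \/
         X = E (n + j.+2) i.+2 - E (n + i.+2) j.+2) |
      exists i : 'I_n,
        X = E i.+2 1 - E 1 (n + i.+2) \/ X = E 1 i.+2 - E (n + i.+2) 1].

Definition so : mat -> Prop := lin_span is_so_gen.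
Definition cartan : mat -> Prop := lin_span is_cartan_gen.
Definition so_plus : mat -> Prop := lin_span is_positive_root_vector.

(* coroot i is h_{i+1}. *)
Definition coroot (i : 'I_n) : mat :=
  if (i.+1 < n)%N then
    E i.+2 i.+2 - E (n + i.+2) (n + i.+2) - E i.+3 i.+3 + E (n + i.+3) (n + i.+3)
  else 2 *: (E n.+1 n.+1 - E n.*2.+1 n.*2.+1).

(* fund_weight 0 = 0; for 0 < i <= n, fund_weight i is the i-th member of the
   dual basis of h_1, ..., h_n, see fund_weight_coroot.  Only its values on
   the Cartan subalgebra are meaningful. *)
Definition fund_weight (i : nat) (h : mat) : C :=
  if i is j.+1 then
    if insub j is Some l then coord [tuple coroot r | r < n] l h else 0
  else 0.

(* T = {2, ..., n+1}; an ordinal j is the position of the index j + 1. *)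
Definition Tset : {set 'I_(n.*2.+1)} := [set j : 'I_(n.*2.+1) | (1 <= j <= n)%N].

Definition so_act : mat -> poly -> poly := gl_act Tset.

Definition A_ (k : int) : poly -> Prop := graded_part Tset k.

Definition Delta (f : poly) : poly :=
  pd 1 (pd 1 f) - 2 *: \sum_(i < n) x i.+2 * pd (n + i.+2) f.

Definition eta (f : poly) : poly :=
  x 1 ^+ 2 * f + 2 *: \sum_(i < n) x (n + i.+2) * pd i.+2 f.

Definition H_ (k : int) (f : poly) : Prop := A_ k f /\ Delta f = 0.

Definition f1 (q : nat) : poly :=
  \sum_(i < q.+1)
    ((q`!)%:R / (i`! * (q - i)`! * double_fact (1 + 2 * q - 2 * i))%:R) *:
    (x 1 ^+ (1 + 2 * q - 2 * i) * x n.+1 ^+ (q - i) * x n.*2.+1 ^+ i).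

(* The index set of the basis: alpha_1 plays the role of epsilon. *)
Definition basis_index (k : int) (alpha : 'X_{1..n.*2.+1}) : Prop :=
  (alpha (ix 1) <= 1)%N /\
  (alpha (ix 1))%:Z
    + \sum_(i < n) ((alpha (ix (n + i.+2)))%:Z - (alpha (ix i.+2))%:Z) = k.

(* r i stands for r_{i+2}.  The binomials vanish unless r_{i+1} is at most
   alpha_{n+i+1} for all i, so the sum may be cut at the maximum of these. *)
Definition basis_poly (alpha : 'X_{1..n.*2.+1}) : poly :=
  let eps := alpha (ix 1) in
  let bound := \max_(i < n) alpha (ix (n + i.+2)) in
  \sum_(r : {ffun 'I_n -> 'I_bound.+1})
    let R := (\sum_(i < n) r i)%N in
    ((2 ^ R * eps`! * R`! * \prod_(i < n) 'C(alpha (ix (n + i.+2)), r i))%:R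
      / ((eps + 2 * R)`!)%:R) *:
    (x 1 ^+ (eps + 2 * R) *
     \prod_(i < n) (x i.+2 ^+ (alpha (ix i.+2) + r i) *
                    x (n + i.+2) ^+ (alpha (ix (n + i.+2)) - r i))).

End OddOrthogonal.

Section FundamentalWeights.
Variables (C : numFieldType) (n : nat).

Fact ix_eq p q : (0 < p <= n.*2.+1)%N -> (0 < q <= n.*2.+1)%N ->
  (ix n p == ix n q) = (p == q).
Proof.
by case: p q => [|p] [|q] //= Hp Hq; rewrite -val_eqE /= !inordK.
Qed.

Fact coroot_diag (i j : 'I_n) : (j <= i)%N ->
  coroot C i (ix n j.+2) (ix n j.+2) =
  (i == j)%:R * (if (i.+1 < n)%N then 1 else 2).
Proof.
move=> le_ji; have lt_in := ltn_ord i.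
have eij : (i == j) = (i == j :> nat) by [].
rewrite /coroot eij; case: ltnP => Hi; rewrite !mxE !ix_eq ?andbb; try lia.
- have -> : (j.+2 == (n + i.+2)%N) = false by lia.
  have -> : (j.+2 == (n + i.+3)%N) = false by lia.
  have -> : (j.+2 == i.+3) = false by lia.
  have -> : (j.+2 == i.+2) = (i == j :> nat) by lia.
  by rewrite !subr0 addr0 mulr1.
- have -> : (j.+2 == n.*2.+1) = false by lia.
  have -> : (j.+2 == n.+1) = (i == j :> nat) by lia.
  by rewrite subr0 mulrC.
Qed.

Fact nth_coroot (i : 'I_n) : [tuple coroot C r | r < n]`_i = coroot C i.
Proof. by rewrite -tnth_nth tnth_mktuple. Qed.

Fact coroot_free : free [tuple coroot C r | r < n].
Proof.
apply/freeP => k Hk i.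
have [m le_im] := ubnP (i : nat); elim: m i le_im => // m IHm i le_im.
have := congr1 (fun X : 'M[C]_(n.*2.+1) => X (ix n i.+2) (ix n i.+2)) Hk.
rewrite summxE (bigD1 i) //= big1 ?addr0 => [|j neq_ji].
  rewrite nth_coroot !mxE coroot_diag // eqxx mul1r => /eqP.
  rewrite mulf_eq0 => /orP[/eqP //|]; case: ifP => _.
    by rewrite oner_eq0.
  by rewrite pnatr_eq0.
rewrite nth_coroot mxE; case: (ltnP j i) => [lt_ji|le_ij].
  by rewrite IHm ?mul0r // (leq_trans lt_ji).
by rewrite coroot_diag // (negbTE neq_ji) mul0r mulr0.
Qed.

Lemma fund_weight_coroot (i j : 'I_n) :
  fund_weight i.+1 (coroot C j) = (i == j)%:R.
Proof.
rewrite /fund_weight insubT //= => lt_in.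
have := coord_free j (Ordinal lt_in) coroot_free.
rewrite nth_coroot => ->.
by rewrite -!val_eqE /= eq_sym.
Qed.

End FundamentalWeights.

(* Main.v *)
(** Write z = x_1, y_i = x_{i+1}, w_i = x_{n+i+1}, Y = sum_i y_i d/dw_i and
    X = sum_i w_i d/dy_i, so that Delta = dz^2 - 2 Y and eta = z^2 + 2 X.

    - [Delta, eta] acts on A_k as 4 k + 2 and Delta is locally nilpotent: by
      this sl2-like relation Delta eta is bijective on A_(k-2), so that
      A_k = H_k + eta A_(k-2) is a direct sum.
    - Delta f = 0 determines f from its terms of degree at most 1 in z, and these
      are arbitrary: this gives the basis.
    - The operators D_i = (d/dy_i) dz - z d/dw_i and F_i = z y_i + w_i dz generate
      so(2n+1). In a nonzero submodule of H_k, a nonzero vector of least weight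
      is killed by all D_i and by all N_il = y_l d/dy_i + w_l d/dw_i, and its
      terms of degree at most 1 in z reduce to a multiple of z w_l^(k-1) or of
      y_l^(-k). Acting on it with the N_li, then with the F_i, produces all
      monomials of degree at most 1 in z, hence all of H_k. *)
From HB Require Import structures.
Require Import Defs.
From mathcomp Require Import all_boot all_order all_algebra.
From mathcomp Require Import boolp complex reals mpoly.
From mathcomp Require Import zify ring.

Set Implicit Arguments.
Unset Strict Implicit.
Unset Printing Implicit Defensive.

Import Order.TTheory GRing.Theory Num.Theory.
Local Open Scope ring_scope.

(** * Spans and subspaces *)

Section LinearSpan.
Variables (C : fieldType) (V : lmodType C).
Implicit Types P W : V -> Prop.

(** Everything about [H_ k] beyond the splitting is done modulo z^2: a harmonic polynomial divisible
    by z^2 vanishes, so only classes of degree at most 1 in z have to be followed. On these, N_li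
    acts plainly, while F_i exchanges the two degrees: z u goes to w_i u, and a z-free u goes to z
    (y_i u + 2 w_i Y u), because Delta f = 0 forces dz^2 f = 2 Y f. The latter value is not a
    monomial, which is the obstacle to reaching all monomials. It is overcome by summing over i with
    well-chosen u: two such sums combine to -p (2 q + 1) z v, where p and q are the degrees of v in
    the y_i and in the w_i.

    The scalars 4 k + 2 add up along a string to (j + 1) (4 k + 4 j + 2), whose second factor is 2
    modulo 4, hence never zero: no k is exceptional.

    Every nonzero submodule of [H_ k] contains a vector with the same nonzero class modulo z^2, so
    that one argument gives both irreducibility and generation by the highest weight vector. *)

Lemma lin_span_gen P v : P v -> lin_span P v.
Proof.
move=> Pv; exists [:: (1, v)]; rewrite big_seq1 scale1r; split=> // cu.
by rewrite inE => /eqP ->.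
Qed.

Lemma lin_span_subspace P : is_subspace (lin_span P).
Proof.
split=> [|c u v [s [Ps ->]] [t [Pt ->]]].
  by exists [::]; rewrite big_nil; split.
exists ([seq (c * cu.1, cu.2) | cu <- s] ++ t); split=> [cu|].
  by rewrite mem_cat => /orP[/mapP[du sdu ->]|/Pt //]; apply: Ps sdu.
rewrite big_cat big_map scaler_sumr; congr (_ + _).
by apply: eq_bigr => cu _; rewrite scalerA.
Qed.

Lemma subspaceZ W c v : is_subspace W -> W v -> W (c *: v).
Proof. by move=> [W0 WD] Wv; rewrite -[_ *: _]addr0; apply: WD. Qed.

Lemma subspaceD W u v : is_subspace W -> W u -> W v -> W (u + v).
Proof. by move=> [_ WD] Wu Wv; rewrite -[u]scale1r; apply: WD. Qed.

Lemma subspaceN W u : is_subspace W -> W u -> W (- u).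
Proof. by move=> sW Wu; rewrite -scaleN1r; apply: subspaceZ. Qed.

Lemma subspaceB W u v : is_subspace W -> W u -> W v -> W (u - v).
Proof. by move=> sW Wu Wv; apply: subspaceD => //; apply: subspaceN. Qed.

Lemma subspace_sum W (I : eqType) (r : seq I) (Q : pred I) F :
  is_subspace W -> (forall i, i \in r -> Q i -> W (F i)) ->
  W (\sum_(i <- r | Q i) F i).
Proof.
move=> sW WF; rewrite big_seq_cond; apply: (big_ind W) => [||i /andP[]] //.
- by case: sW.
- by move=> u v; apply: subspaceD.
- exact: WF.
Qed.

Lemma lin_span_sub P W : is_subspace W -> (forall v, P v -> W v) ->
  forall v, lin_span P v -> W v.
Proof.
move=> sW PW v [s [Ps ->]]; apply: subspace_sum => // cu scu _.
by apply: subspaceZ => //; apply: PW; apply: Ps.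
Qed.

End LinearSpan.

(** * Conditions on the exponents of a polynomial *)

Section Support.
Variables (C : numFieldType) (m : nat).
Implicit Types (P Q : 'X_{1..m} -> Prop) (f g : {mpoly C[m]}).

(** Homogeneity, divisibility by z and bounds on weighted degrees all take this form, so that
    [onsuppXM] and [onsupp_deriv] carry each of them through the operators. *)
Definition onsupp P f := forall a, f@_a != 0 -> P a.

Lemma onsupp_subspace P : is_subspace (onsupp P).
Proof.
split=> [a|c f g Pf Pg a]; first by rewrite mcoeff0 eqxx.
rewrite mcoeffD mcoeffZ; have [->|/Pf //] := eqVneq f@_a 0.
by rewrite mulr0 add0r => /Pg.
Qed.

Lemma onsuppD P f g : onsupp P f -> onsupp P g -> onsupp P (f + g).
Proof. exact: (subspaceD (onsupp_subspace P)). Qed.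

Lemma onsuppN P f : onsupp P f -> onsupp P (- f).
Proof. exact: (subspaceN (onsupp_subspace P)). Qed.

Lemma onsuppZ P c f : onsupp P f -> onsupp P (c *: f).
Proof. exact: (subspaceZ c (onsupp_subspace P)). Qed.

Lemma onsuppMn P f k : onsupp P f -> onsupp P (f *+ k).
Proof. by rewrite -scaler_nat; apply: onsuppZ. Qed.

Lemma onsupp_sum P (I : eqType) (r : seq I) (Q : pred I) F :
  (forall i, i \in r -> Q i -> onsupp P (F i)) ->
  onsupp P (\sum_(i <- r | Q i) F i).
Proof. exact: (subspace_sum (onsupp_subspace P)). Qed.

Lemma onsuppW P Q f : (forall a, P a -> Q a) -> onsupp P f -> onsupp Q f.
Proof. by move=> PQ Pf a /Pf/PQ. Qed.

Lemma onsuppX P a : P a -> onsupp P 'X_[a].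
Proof. by move=> Pa b; rewrite mcoeffX pnatr_eq0 eqb0 negbK => /eqP <-. Qed.

Lemma onsupp0 f : onsupp (fun=> False) f -> f = 0.
Proof.
move=> Pf; apply/mpolyP => a; rewrite mcoeff0; apply/eqP.
by have [//|/Pf] := eqVneq f@_a 0.
Qed.

Lemma mcoeffXM i f a :
  ('X_i * f)@_a = if (0 < a i)%N then f@_(a - U_(i)) else 0.
Proof.
rewrite mulrC; case: ifP => [ai|/negbT ai].
  have Ua : (U_(i) <= a)%MM by rewrite lep1mP -lt0n.
  by rewrite -[in LHS](submK Ua) addmC mcoeffMX.
apply/eqP; rewrite mcoeff_eq0; apply: contra ai.
rewrite (perm_mem (msuppMX _ _)) => /mapP[b _ ->].
by rewrite mnmDE mnm1E eqxx.
Qed.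

Lemma onsuppXM P Q i f : (forall a, P a -> Q (a + U_(i))%MM) ->
  onsupp P f -> onsupp Q ('X_i * f).
Proof.
move=> PQ Pf a; rewrite mcoeffXM; case: ifP => [ai /Pf/PQ|];
  last by rewrite eqxx.
by rewrite submK // lep1mP -lt0n.
Qed.

Lemma onsupp_deriv P Q i f : (forall a, P (a + U_(i))%MM -> Q a) ->
  onsupp P f -> onsupp Q f^`M(i).
Proof.
move=> PQ Pf a; rewrite mcoeff_deriv => fa; apply: PQ; apply: Pf.
by apply: contraNneq fa => ->; rewrite mul0rn.
Qed.

Lemma mderivXM i j f : ('X_i * f)^`M(j) = (i == j)%:R * f + 'X_i * f^`M(j).
Proof.
rewrite mderivM mderivX mnm1E; case: eqVneq => [->|_].
  by rewrite -[X in (X - _)%MM]add0m addmK mpolyX0 scale1r mul1r.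
by rewrite scale0r mul0r.
Qed.

Lemma XM_mderivX i (a : 'X_{1..m}) :
  'X_i * ('X_[a])^`M(i) = (a i)%:R *: 'X_[C, a].
Proof.
rewrite mderivX -scalerAr; have [->|ai] := posnP (a i);
  first by rewrite !scale0r.
by rewrite mulrC -mpolyXD submK // lep1mP -lt0n.
Qed.

Lemma mcoeff_XMderiv i f a : ('X_i * f^`M(i))@_a = (a i)%:R * f@_a.
Proof.
rewrite mcoeffXM; case: posnP => [->|ai]; first by rewrite mul0r.
rewrite mcoeff_deriv submK ?lep1mP -?lt0n // mnmBE mnm1E eqxx subn1 prednK //.
by rewrite mulr_natl.
Qed.

End Support.

(** * The three groups of variables z, y_i, w_i *)

Section Indices.
Variable n : nat.
Implicit Types i j : 'I_n.

Lemma iyP i : (0 < i.+2 <= n.*2.+1)%N. Proof. by have := ltn_ord i; lia. Qed.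
Lemma iwP i : (0 < n + i.+2 <= n.*2.+1)%N. Proof. by have := ltn_ord i;
  lia. Qed.

Lemma ix_val p : (0 < p <= n.*2.+1)%N -> ix n p = p.-1 :> nat.
Proof. by case: p => // p /= ltp; rewrite inordK. Qed.

Lemma ixE :
  (forall i, (ix n 1 == ix n i.+2) = false) *
  (forall i, (ix n 1 == ix n (n + i.+2)) = false) *
  (forall i, (ix n i.+2 == ix n 1) = false) *
  (forall i, (ix n (n + i.+2) == ix n 1) = false) *
  (forall i j, (ix n i.+2 == ix n j.+2) = (i == j)) *
  (forall i j, (ix n (n + i.+2) == ix n (n + j.+2)) = (i == j)) *
  (forall i j, (ix n i.+2 == ix n (n + j.+2)) = false) *
  (forall i j, (ix n (n + j.+2) == ix n i.+2) = false).
Proof.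
have iyw i j : (i.+2 == n + j.+2)%N = false by have := ltn_ord i; lia.
do ![apply: pair]=> [i|i|i|i|i j|i j|i j|i j];
  rewrite ix_eq ?iyP ?iwP ?eqn_add2l ?iyw //.
- by lia.
- by lia.
- by rewrite eq_sym iyw.
Qed.

End Indices.

HB.lock Definition iz n : 'I_(n.*2.+1) := ix n 1.
HB.lock Definition iy n (i : 'I_n) : 'I_(n.*2.+1) := ix n i.+2.
HB.lock Definition iw n (i : 'I_n) : 'I_(n.*2.+1) := ix n (n + i.+2).

Section ColouredIndices.
Variable n : nat.
Implicit Types i j : 'I_n.

Lemma ix_fold : (ix n 1 = iz n) * (forall i, ix n i.+2 = iy i) *
  (forall i, ix n (n + i.+2) = iw i).
Proof. by rewrite iz.unlock iy.unlock iw.unlock. Qed.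

Lemma iE :
  (forall i, (iz n == iy i) = false) * (forall i, (iz n == iw i) = false) *
  (forall i, (iy i == iz n) = false) * (forall i, (iw i == iz n) = false) *
  (forall i j, (iy i == iy j) = (i == j)) *
  (forall i j, (iw i == iw j) = (i == j)) *
  (forall i j, (iy i == iw j) = false) * (forall i j, (iw j == iy i) = false).
Proof. by rewrite iz.unlock iy.unlock iw.unlock; apply: ixE. Qed.

Lemma big_ix (V : nmodType) (F : 'I_(n.*2.+1) -> V) :
  \sum_j F j = F (iz n) + \sum_(i < n) F (iy i) + \sum_(i < n) F (iw i).
Proof.
have -> : \sum_j F j = \sum_(j < n.*2.+1) F (ix n j.+1).
  by apply: eq_bigr => j _; congr F; apply: val_inj; rewrite /= ix_val ?ltn_ord.
rewrite big_ord_recl -addrA; congr (_ + _); first by rewrite iz.unlock.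
pose G (j : nat) := F (ix n j.+2).
rewrite (eq_bigr (fun j : 'I_n.*2 => G j)) // -(big_mkord xpredT G).
rewrite (big_cat_nat (leq0n n)) /=; last by lia.
rewrite big_mkord; congr (_ + _); first by rewrite iy.unlock.
have -> : index_iota n n.*2 = index_iota (0 + n) n.*2 by [].
rewrite big_addn -addnn addnK big_mkord.
by apply: eq_bigr => i _; rewrite iw.unlock /G addnC !addnS.
Qed.

Lemma mnm_iP (a b : 'X_{1..n.*2.+1}) :
  a (iz n) = b (iz n) -> (forall i, a (iy i) = b (iy i)) ->
  (forall i, a (iw i) = b (iw i)) -> a = b.
Proof.
rewrite iz.unlock iy.unlock iw.unlock => ez ey ew; apply/mnmP => j.
have ltj := ltn_ord j; case: (posnP j) => [j0|jgt0].
  by rewrite (_ : j = ix n 1) //; apply: val_inj; rewrite /= ix_val.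
case: (leqP j n) => ltnj.
  have ltj1 : (j.-1 < n)%N by lia.
  rewrite (_ : j = ix n (Ordinal ltj1).+2) //; apply: val_inj.
  by rewrite /= ix_val /=; lia.
have ltj1 : (j - n.+1 < n)%N by lia.
rewrite (_ : j = ix n (n + (Ordinal ltj1).+2)) //; apply: val_inj.
by rewrite /= ix_val /=; lia.
Qed.

Lemma in_Tset :
  ((iz n \in Tset n) = false) * (forall i, (iy i \in Tset n) = true) *
  (forall i, (iw i \in Tset n) = false).
Proof.
rewrite iz.unlock iy.unlock iw.unlock.
by do ![apply: pair]=> [|i|i]; rewrite inE ix_val ?iyP ?iwP //;
  have := ltn_ord i; lia.
Qed.

Lemma gradeE (a : 'X_{1..n.*2.+1}) : grade (Tset n) a =
  (a (iz n))%:Z + \sum_(i < n) ((a (iw i))%:Z - (a (iy i))%:Z).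
Proof.
rewrite /grade big_mkcond [X in _ - X]big_mkcond /=.
rewrite -sumrB big_ix -addrA; congr (_ + _).
  by rewrite in_setC !in_Tset /= subr0.
rewrite -big_split /=; apply: eq_bigr => i _.
by rewrite !in_setC !in_Tset /= sub0r subr0 addrC.
Qed.

End ColouredIndices.

(* The indices, variables and derivations are locked because otherwise
   matching them against each other unfolds the arithmetic of the indices and
   the definition of derivatives. *)
HB.lock Definition zv (C : numFieldType) n : {mpoly C[n.*2.+1]} := 'X_(iz n).
HB.lock Definition yv (C : numFieldType) n (i : 'I_n) : {mpoly C[n.*2.+1]} :=
  'X_(iy i).
HB.lock Definition wv (C : numFieldType) n (i : 'I_n) : {mpoly C[n.*2.+1]} :=
  'X_(iw i).
HB.lock Definition dz (C : numFieldType) n (f : {mpoly C[n.*2.+1]}) :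
  {mpoly C[n.*2.+1]} := f^`M(iz n).
HB.lock Definition dy (C : numFieldType) n (i : 'I_n) (f : {mpoly C[n.*2.+1]}) :
  {mpoly C[n.*2.+1]} := f^`M(iy i).
HB.lock Definition dw (C : numFieldType) n (i : 'I_n) (f : {mpoly C[n.*2.+1]}) :
  {mpoly C[n.*2.+1]} := f^`M(iw i).

HB.lock Definition Yop (C : numFieldType) n (f : {mpoly C[n.*2.+1]}) :
  {mpoly C[n.*2.+1]} := \sum_(i < n) yv C i * dw i f.
HB.lock Definition Xop (C : numFieldType) n (f : {mpoly C[n.*2.+1]}) :
  {mpoly C[n.*2.+1]} := \sum_(i < n) wv C i * dy i f.

Definition polyE := (zv.unlock, yv.unlock, wv.unlock, dz.unlock, dy.unlock,
  dw.unlock).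

(** * The action of so(2n+1) by differential operators *)

Section Operators.
Variables (C : numFieldType) (n : nat).
Local Notation poly := {mpoly C[n.*2.+1]}.
Implicit Types (i j : 'I_n) (f g : poly) (c : C).

Local Notation z := (zv C n).
Local Notation y i := (yv C i).
Local Notation w i := (wv C i).

Fact dz_is_linear : linear (@dz C n).
Proof. by rewrite dz.unlock => c f g; rewrite linearP. Qed.
HB.instance Definition _ := GRing.isLinear.Build C poly poly _ (@dz C n)
  dz_is_linear.
Fact dy_is_linear i : linear (@dy C n i).
Proof. by rewrite dy.unlock => c f g; rewrite linearP. Qed.
HB.instance Definition _ i :=
  GRing.isLinear.Build C poly poly _ (@dy C n i) (dy_is_linear i).
Fact dw_is_linear i : linear (@dw C n i).
Proof. by rewrite dw.unlock => c f g; rewrite linearP. Qed.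
HB.instance Definition _ i :=
  GRing.isLinear.Build C poly poly _ (@dw C n i) (dw_is_linear i).

Lemma derXM :
  (forall f, dz (z * f) = f + z * dz f) *
  (forall i f, dz (y i * f) = y i * dz f) *
  (forall i f, dz (w i * f) = w i * dz f) *
  (forall i f, dy i (z * f) = z * dy i f) *
  (forall i f, dw i (z * f) = z * dw i f) *
  (forall i j f, dy i (y j * f) = (j == i)%:R * f + y j * dy i f) *
  (forall i j f, dw i (w j * f) = (j == i)%:R * f + w j * dw i f) *
  (forall i j f, dy i (w j * f) = w j * dy i f) *
  (forall i j f, dw i (y j * f) = y j * dw i f).
Proof.
by rewrite !polyE; do ![apply: pair]=> *;
  rewrite mderivXM ?iE ?eqxx ?mul0r ?add0r ?mul1r.
Qed.

Lemma derC :
  (forall i f, dy i (dz f) = dz (dy i f)) *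
  (forall i f, dw i (dz f) = dz (dw i f)) *
  (forall i j f, dw i (dy j f) = dy j (dw i f)).
Proof.
by rewrite !polyE; do ![apply: pair]=> *; rewrite mderiv_comm.
Qed.

Lemma dyC i j f : dy i (dy j f) = dy j (dy i f).
Proof. by rewrite polyE mderiv_comm. Qed.

Lemma dwC i j f : dw i (dw j f) = dw j (dw i f).
Proof. by rewrite polyE mderiv_comm. Qed.

(** Up to sign, and up to a scalar on the diagonal, [Nop] is the action of the subalgebra gl(n), and
    [Dop] and [Fop] are those of the positive and negative short root vectors. *)
Definition Nop i j f := y j * dy i f + w j * dw i f.
Definition Dop i f := dy i (dz f) - z * dw i f.
Definition Fop i f := z * y i * f + w i * dz f.

Lemma Delta_Yop f : Delta f = dz (dz f) - Yop f *+ 2.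
Proof.
rewrite /Delta scaler_nat Yop.unlock !polyE !ix_fold.
by under eq_bigr do rewrite !ix_fold.
Qed.

Lemma eta_Xop f : eta f = z ^+ 2 * f + Xop f *+ 2.
Proof.
rewrite /eta scaler_nat Xop.unlock !polyE !ix_fold.
by under eq_bigr do rewrite !ix_fold.
Qed.

Lemma so_act_E p q f :
  so_act (E C n p q) f = gl_unit_act (Tset n) (ix n p) (ix n q) f.
Proof.
rewrite /so_act /gl_act (bigD1 (ix n p)) //= [X in _ + X]big1 ?addr0.
  rewrite (bigD1 (ix n q)) //= [X in _ + X]big1 ?addr0.
    by rewrite mxE !eqxx scale1r.
  by move=> l neq_l; rewrite mxE (negbTE neq_l) andbF scale0r.
move=> l neq_l; rewrite big1 // => j _.
by rewrite mxE (negbTE neq_l) scale0r.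
Qed.

Lemma so_act_lin c (A B : 'M[C]_(n.*2.+1)) f :
  so_act (c *: A + B) f = c *: so_act A f + so_act B f.
Proof.
rewrite /so_act /gl_act scaler_sumr -big_split; apply: eq_bigr => i _ /=.
rewrite scaler_sumr -big_split; apply: eq_bigr => j _ /=.
by rewrite !mxE scalerDl scalerA.
Qed.

Lemma so_act0 f : so_act 0 f = 0.
Proof. by have := so_act_lin (-1) 0 0 f;
  rewrite scaler0 addr0 scaleN1r addNr. Qed.

Lemma so_actB (A B : 'M[C]_(n.*2.+1)) f : so_act (A - B) f = so_act A f -
  so_act B f.
Proof. by rewrite addrC -scaleN1r so_act_lin scaleN1r addrC. Qed.

(** The scalar at [i = j] comes from the term -delta_{i,j} in the action of E_{i,j} for i, j in T;
    it produces the -1 in every weight coordinate. *)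
Lemma so_act_Nop i j f :
  so_act (E C n i.+2 j.+2 - E C n (n + j.+2) (n + i.+2)) f =
  - (Nop i j f + (i == j)%:R *: f).
Proof.
rewrite so_actB !so_act_E !ix_fold /gl_unit_act !in_Tset ?polyE !iE /Nop ?polyE.
by rewrite -!opprD addrAC.
Qed.

Lemma so_act_Bop i j f :
  so_act (E C n i.+2 (n + j.+2) - E C n j.+2 (n + i.+2)) f =
  dy i (dw j f) - dy j (dw i f).
Proof. by rewrite so_actB !so_act_E !ix_fold /gl_unit_act !in_Tset /Dop ?polyE.
  Qed.

Lemma so_act_Cop i j f :
  so_act (E C n (n + j.+2) i.+2 - E C n (n + i.+2) j.+2) f =
  y j * w i * f - y i * w j * f.
Proof.
rewrite so_actB !so_act_E !ix_fold /gl_unit_act !in_Tset opprK addrC.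
by rewrite ![yv _ _ * _]mulrC ?polyE.
Qed.

Lemma so_act_Dop i f : so_act (E C n i.+2 1 - E C n 1 (n + i.+2)) f = Dop i f.
Proof. by rewrite so_actB !so_act_E !ix_fold /gl_unit_act !in_Tset /Dop ?polyE.
  Qed.

Lemma so_act_Fop i f :
  so_act (E C n 1 i.+2 - E C n (n + i.+2) 1) f = - Fop i f.
Proof. by rewrite so_actB !so_act_E !ix_fold /gl_unit_act !in_Tset /Fop ?polyE
  opprD. Qed.

Lemma YopE f : Yop f = \sum_(i < n) y i * dw i f. Proof. by rewrite Yop.unlock.
  Qed.
Lemma XopE f : Xop f = \sum_(i < n) w i * dy i f. Proof. by rewrite Xop.unlock.
  Qed.

Fact Yop_is_linear : linear (@Yop C n).
Proof.
move=> c f g; rewrite Yop.unlock scaler_sumr -big_split;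
  apply: eq_bigr => i _ /=.
by rewrite linearP mulrDr scalerAr.
Qed.
HB.instance Definition _ := GRing.isLinear.Build C poly poly _ (@Yop C n)
  Yop_is_linear.

Fact Xop_is_linear : linear (@Xop C n).
Proof.
move=> c f g; rewrite Xop.unlock scaler_sumr -big_split;
  apply: eq_bigr => i _ /=.
by rewrite linearP mulrDr scalerAr.
Qed.
HB.instance Definition _ := GRing.isLinear.Build C poly poly _ (@Xop C n)
  Xop_is_linear.

Fact Delta_is_linear : linear (@Delta C n).
Proof.
move=> c f g; rewrite !Delta_Yop !linearP /= mulrnDl scalerBr scalerMnr.
by rewrite opprD addrACA.
Qed.
HB.instance Definition _ :=
  GRing.isLinear.Build C poly poly _ (@Delta C n) Delta_is_linear.

Fact eta_is_linear : linear (@eta C n).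
Proof.
move=> c f g; rewrite !eta_Xop !linearP /= mulrnDl scalerDr scalerMnr.
by rewrite mulrDr -scalerAr addrACA.
Qed.
HB.instance Definition _ :=
  GRing.isLinear.Build C poly poly _ (@eta C n) eta_is_linear.

Lemma sum_delta i (F : 'I_n -> poly) f :
  \sum_(j < n) F j * ((i == j)%:R * f) = F i * f.
Proof.
rewrite (bigD1 i) //= eqxx mul1r big1 ?addr0 // => j.
by rewrite eq_sym => /negbTE ->; rewrite mul0r mulr0.
Qed.

Lemma derYop :
  (forall f, Yop (z * f) = z * Yop f) *
  (forall i f, Yop (y i * f) = y i * Yop f) *
  (forall i f, Yop (w i * f) = y i * f + w i * Yop f) *
  (forall f, dz (Yop f) = Yop (dz f)) *
  (forall i f, dy i (Yop f) = dw i f + Yop (dy i f)) *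
  (forall i f, dw i (Yop f) = Yop (dw i f)).
Proof.
do ![apply: pair] => [f|i f|i f|f|i f|i f];
  rewrite Yop.unlock ?linear_sum ?mulr_sumr /=.
- by apply: eq_bigr => j _; rewrite derXM mulrCA.
- by apply: eq_bigr => j _; rewrite derXM mulrCA.
- under eq_bigr do rewrite derXM mulrDr.
  rewrite big_split sum_delta /=; congr (_ + _).
  by apply: eq_bigr => j _; rewrite mulrCA.
- by apply: eq_bigr => j _; rewrite derXM derC.
- under eq_bigr do rewrite derXM -derC eq_sym.
  rewrite big_split /=; congr (_ + _).
  rewrite (bigD1 i) //= eqxx mul1r big1 ?addr0 // => j.
  by rewrite eq_sym => /negbTE ->; rewrite mul0r.
- by apply: eq_bigr => j _; rewrite derXM dwC.
Qed.

Lemma derXop :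
  (forall f, Xop (z * f) = z * Xop f) *
  (forall i f, Xop (w i * f) = w i * Xop f) *
  (forall i f, Xop (y i * f) = w i * f + y i * Xop f) *
  (forall f, dz (Xop f) = Xop (dz f)) *
  (forall i f, dw i (Xop f) = dy i f + Xop (dw i f)) *
  (forall i f, dy i (Xop f) = Xop (dy i f)).
Proof.
do ![apply: pair] => [f|i f|i f|f|i f|i f];
  rewrite Xop.unlock ?linear_sum ?mulr_sumr /=.
- by apply: eq_bigr => j _; rewrite derXM mulrCA.
- by apply: eq_bigr => j _; rewrite derXM mulrCA.
- under eq_bigr do rewrite derXM mulrDr.
  rewrite big_split sum_delta /=; congr (_ + _).
  by apply: eq_bigr => j _; rewrite mulrCA.
- by apply: eq_bigr => j _; rewrite derXM derC.
- under eq_bigr do rewrite derXM derC eq_sym.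
  rewrite big_split /=; congr (_ + _).
  rewrite (bigD1 i) //= eqxx mul1r big1 ?addr0 // => j.
  by rewrite eq_sym => /negbTE ->; rewrite mul0r.
- by apply: eq_bigr => j _; rewrite derXM dyC.
Qed.

Local Notation linear_rules u :=
  ((forall f g, (u (f + g) = u f + u g)%R) * (forall f, (u (- f) = - u f)%R) *
   (forall f k, (u (f *+ k) = u f *+ k)%R) *
   (forall f (k : nat), (u (k%:R * f) = k%:R * u f)%R))%type.

Fact linear_rulesP (u : poly -> poly) : linear u -> linear_rules u.
Proof.
move=> linu; pose U : {linear poly -> poly} :=
  HB.pack u (GRing.isLinear.Build C poly poly _ u linu).
do ![apply: pair] => *; rewrite ?mulr_natl;
by [exact: (linearD U) | exact: (linearN U) | exact: (linearMn U)].
Qed.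

Lemma linE :
  linear_rules (@dz C n) * (forall i, linear_rules (@dy C n i)) *
  (forall i, linear_rules (@dw C n i)) * linear_rules (@Yop C n) *
  linear_rules (@Xop C n).
Proof.
by split; [split; [split; [split|]|]|] => *; apply: linear_rulesP;
  exact: linearP.
Qed.

(** Rewriting with these rules moves operators past multiplications and orders derivations of
    different kinds; operator identities then become ring identities between the resulting
    values. *)
Definition opE := (derXM, derYop, derXop, derC, linE).

(** [Xop] and [Yop] span an sl2 with the difference of the two Euler operators, the part of the
    grading operator that does not involve z. *)
Lemma Yop_Xop f :
  Yop (Xop f) = Xop (Yop f) + \sum_(i < n) (y i * dy i f - w i * dw i f).
Proof.
rewrite {1 2}Xop.unlock linear_sum -big_split /=.
by apply: eq_bigr => i _; rewrite !derYop; ring.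
Qed.

Lemma Delta_Dop i f : Delta (Dop i f) = Dop i (Delta f).
Proof. by rewrite /Dop !Delta_Yop !opE; ring. Qed.

Lemma Delta_Fop i f : Delta (Fop i f) = Fop i (Delta f).
Proof. by rewrite /Fop !Delta_Yop -!mulrA !opE; ring. Qed.

Lemma Dop_Fop i j f :
  Dop i (Fop j f) - Fop j (Dop i f) = Nop i j f + (i == j)%:R * f.
Proof. by rewrite /Dop /Fop /Nop -!mulrA !opE [j == i]eq_sym; ring. Qed.

Lemma Dop_Dop i j f :
  Dop j (Dop i f) - Dop i (Dop j f) = dy i (dw j f) - dy j (dw i f).
Proof.
rewrite /Dop !opE [dy j (dy i f)]dyC [dw j (dw i f)]dwC; ring.
Qed.

Lemma Fop_Fop i j f :
  Fop j (Fop i f) - Fop i (Fop j f) = y i * w j * f - y j * w i * f.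
Proof. by rewrite /Fop -!mulrA !opE; ring. Qed.

End Operators.

(** * Weighted degrees *)

Section Weights.
Variables (C : numFieldType) (m : nat) (v : 'I_m -> nat).
Implicit Types a b : 'X_{1..m}.

(** The measure of all inductions on monomials: the weights are chosen for the nilpotency of Delta,
    for the descent to a singular vector and for the generation of all monomials. *)
Definition wt a := (\sum_j v j * a j)%N.

Lemma wtD a b : wt (a + b)%MM = (wt a + wt b)%N.
Proof. by rewrite -big_split; apply: eq_bigr => j _; rewrite mnmDE mulnDr. Qed.

Lemma wtU j : wt U_(j)%MM = v j.
Proof.
rewrite /wt (bigD1 j) //= mnm1E eqxx muln1 big1 ?addn0 // => i.
by rewrite mnm1E eq_sym => /negbTE ->; rewrite muln0.
Qed.

Lemma wt_bounded (f : {mpoly C[m]}) : exists N, onsupp (fun a => wt a < N)%N f.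
Proof.
exists (\max_(a <- msupp f) wt a).+1 => a; rewrite -mcoeff_msupp ltnS => fa.
by apply: (leq_bigmax_seq (F := wt)).
Qed.

End Weights.

(** * The grading and the bracket of Delta and eta *)

Section Grading.
Variables (C : numFieldType) (n : nat).
Local Notation poly := {mpoly C[n.*2.+1]}.
Implicit Types (i j : 'I_n) (f g : poly) (k : int).
Local Notation z := (zv C n).
Local Notation y i := (yv C i).
Local Notation w i := (wv C i).

Lemma A_onsupp k f : A_ k f <-> onsupp (fun a => grade (Tset n) a = k) f.
Proof.
split=> [|fk].
  apply: lin_span_sub => [|_ [a ak ->]]; first exact: onsupp_subspace.
  exact: onsuppX.
rewrite [f]mpolyE; apply: subspace_sum => [|a fa _];
  first exact: lin_span_subspace.
apply: subspaceZ; first exact: lin_span_subspace.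
by apply: lin_span_gen; exists a => //; apply: fk; rewrite -mcoeff_msupp.
Qed.

Lemma A_subspace k : is_subspace (@A_ C n k).
Proof. exact: lin_span_subspace. Qed.

Lemma gradeD (a b : 'X_{1..n.*2.+1}) :
  grade (Tset n) (a + b)%MM = grade (Tset n) a + grade (Tset n) b.
Proof.
rewrite !gradeE mnmDE PoszD [RHS]addrACA; congr (_ + _).
by rewrite -big_split; apply: eq_bigr => i _; rewrite !mnmDE !PoszD /=; ring.
Qed.

Lemma gradeU :
  (grade (Tset n) U_(iz n)%MM = 1) * (forall i, grade (Tset n) U_(iy i)%MM =
    -1) *
  (forall i, grade (Tset n) U_(iw i)%MM = 1).
Proof.
have gU (j : 'I_(n.*2.+1)) :
    grade (Tset n) U_(j)%MM = (j \notin Tset n)%:Z - (j \in Tset n)%:Z.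
  by rewrite /grade -in_setC; congr (_ - _); rewrite big_mkcond (bigD1 j) //=
    mnm1E eqxx big1 ?addr0; try (by case: (j \in _));
    move=> i; rewrite mnm1E eq_sym => /negbTE ->; case: ifP.
by split; [split|] => *; rewrite gU !in_Tset.
Qed.

Lemma A_zv k f : A_ (k - 1) f -> A_ k (z * f).
Proof.
rewrite polyE => /A_onsupp Af; apply/A_onsupp; apply: onsuppXM Af => a.
by rewrite gradeD gradeU => ->; rewrite subrK.
Qed.

Lemma A_wv k i f : A_ (k - 1) f -> A_ k (w i * f).
Proof.
rewrite polyE => /A_onsupp Af; apply/A_onsupp; apply: onsuppXM Af => a.
by rewrite gradeD gradeU => ->; rewrite subrK.
Qed.

Lemma A_yv k i f : A_ (k + 1) f -> A_ k (y i * f).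
Proof.
rewrite polyE => /A_onsupp Af; apply/A_onsupp; apply: onsuppXM Af => a.
by rewrite gradeD gradeU => ->; rewrite addrK.
Qed.

Lemma A_dz k f : A_ (k + 1) f -> A_ k (dz f).
Proof.
rewrite polyE => /A_onsupp Af; apply/A_onsupp; apply: onsupp_deriv Af => a.
by rewrite gradeD gradeU => /addIr.
Qed.

Lemma A_dw k i f : A_ (k + 1) f -> A_ k (dw i f).
Proof.
rewrite polyE => /A_onsupp Af; apply/A_onsupp; apply: onsupp_deriv Af => a.
by rewrite gradeD gradeU => /addIr.
Qed.

Lemma A_dy k i f : A_ (k - 1) f -> A_ k (dy i f).
Proof.
rewrite polyE => /A_onsupp Af; apply/A_onsupp; apply: onsupp_deriv Af => a.
by rewrite gradeD gradeU => /addIr.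
Qed.

Lemma A_D k f g : A_ k f -> A_ k g -> A_ k (f + g).
Proof. by apply: subspaceD; apply: A_subspace. Qed.

Lemma A_N k f : A_ k f -> A_ k (- f).
Proof. by apply: subspaceN; apply: A_subspace. Qed.

Lemma A_Z k (c : C) f : A_ k f -> A_ k (c *: f).
Proof. by apply: subspaceZ; apply: A_subspace. Qed.

Lemma A_sum k (F : 'I_n -> poly) :
  (forall i, A_ k (F i)) -> A_ k (\sum_(i < n) F i).
Proof. by move=> AF; apply: subspace_sum => [|i _ _ //]; exact: A_subspace. Qed.

Lemma A_eq k l f : A_ k f -> k = l -> A_ l f.
Proof. by move=> Af <-. Qed.

Lemma A_Yop k f : A_ (k + 2) f -> A_ k (Yop f).
Proof.
move=> Af; rewrite Yop.unlock; apply: A_sum => i.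
by apply: A_yv; apply: A_dw; apply: A_eq Af _; ring.
Qed.

Lemma A_Xop k f : A_ (k - 2) f -> A_ k (Xop f).
Proof.
move=> Af; rewrite Xop.unlock; apply: A_sum => i.
by apply: A_wv; apply: A_dy; apply: A_eq Af _; ring.
Qed.

Lemma A_Delta k f : A_ (k + 2) f -> A_ k (Delta f).
Proof.
move=> Af; rewrite Delta_Yop -scaler_nat; apply: A_D.
  by apply: A_dz; apply: A_dz; apply: A_eq Af _; ring.
by apply: A_N; apply: A_Z; apply: A_Yop.
Qed.

Lemma A_eta k f : A_ (k - 2) f -> A_ k (eta f).
Proof.
move=> Af; rewrite eta_Xop -scaler_nat expr2 -mulrA; apply: A_D.
  by apply: A_zv; apply: A_zv; apply: A_eq Af _; ring.
by apply: A_Z; apply: A_Xop.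
Qed.

Lemma A_Dop k i f : A_ k f -> A_ k (Dop i f).
Proof.
move=> Af; apply: A_D; first by apply: A_dy; apply: A_dz; apply: A_eq Af _;
  ring.
by apply: A_N; apply: A_zv; apply: A_dw; apply: A_eq Af _; ring.
Qed.

Lemma A_Fop k i f : A_ k f -> A_ k (Fop i f).
Proof.
move=> Af; rewrite /Fop -mulrA; apply: A_D.
  by apply: A_zv; apply: A_yv; apply: A_eq Af _; ring.
by apply: A_wv; apply: A_dz; apply: A_eq Af _; ring.
Qed.

Lemma A_Euler k f : A_ k f ->
  z * dz f + \sum_(i < n) (w i * dw i f - y i * dy i f) = k%:~R *: f.
Proof.
rewrite !polyE => /A_onsupp Af; apply/mpolyP => a.
rewrite mcoeffD mcoeffZ raddf_sum /= mcoeff_XMderiv.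
under eq_bigr do rewrite mcoeffB !mcoeff_XMderiv -mulrBl.
rewrite -mulr_suml -mulrDl; have [->|/Af <-] := eqVneq f@_a 0;
  first by rewrite !mulr0.
rewrite gradeE rmorphD rmorph_sum /=; congr ((_ + _) * _).
by apply: eq_bigr => i _; rewrite rmorphB.
Qed.

(** [dz^2, z^2] = 4 z dz + 2 and [-2 Y, 2 X] = 4 sum_i (w_i dw_i - y_i dy_i), while the cross terms
    commute; the sum is 4 times the Euler operator of [A_Euler], plus 2. *)
Lemma Delta_eta k f : A_ k f ->
  Delta (eta f) = eta (Delta f) + (4 * k + 2)%:~R *: f.
Proof.
move=> Af; rewrite rmorphD rmorphM /= scalerDl -scalerA -(A_Euler Af).
rewrite !Delta_Yop !eta_Xop expr2 -!mulrA !opE Yop_Xop.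
have -> : \sum_(i < n) (w i * dw i f - y i * dy i f) =
  - \sum_(i < n) (y i * dy i f - w i * dw i f).
  by rewrite -sumrN; apply: eq_bigr => i _; rewrite opprB.
by rewrite !scaler_nat; ring.
Qed.

(** The degree in z and the w_i together drops: dz^2 lowers it by 2, and Y, which replaces a w_i by
    y_i, by 1. *)
Lemma Delta_nilpotent f : exists N, iter N (@Delta C n) f = 0.
Proof.
pose v (l : 'I_(n.*2.+1)) : nat := l \notin Tset n.
have [N] := wt_bounded v f.
elim: N f => [|N IHN] f fN; first by exists 0; apply: onsupp0 => a /fN.
suff /IHN[M EM] : onsupp (fun a => wt v a < N)%N (Delta f).
  by exists M.+1; rewrite iterSr.
rewrite Delta_Yop; apply: onsuppD; [|apply: onsuppN].
  rewrite !polyE; apply: (@onsupp_deriv _ _ (fun a => wt v (a + U_(iz n))%MM <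
    N.+1)%N) => [a|].
    by rewrite !wtD !wtU /v !in_Tset; lia.
  by apply: onsupp_deriv fN.
apply: onsuppMn; rewrite Yop.unlock; apply: onsupp_sum => i _ _.
rewrite !polyE; apply: (@onsuppXM _ _ (fun a => wt v (a + U_(iw i))%MM <
  N.+1)%N) => [a|].
  by rewrite !wtD !wtU /v !in_Tset; lia.
by apply: onsupp_deriv fN.
Qed.

End Grading.

(** * The splitting of A_k *)

Section Decomposition.
Variables (C : numFieldType) (n : nat).
Local Notation poly := {mpoly C[n.*2.+1]}.
Implicit Types (f g u v : poly) (k : int) (j : nat).

(* [Delta, eta] summed along the first j + 1 steps of an eta-string starting in
   degree k + 2j and going down. *)
Definition sl2_coef k j : C := (j.+1%:Z * (4 * k + 4 * j%:Z + 2))%:~R.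

(** Since 4 k + 4 j + 2 is 2 modulo 4 it is a nonzero integer, and the characteristic is zero. *)
Lemma sl2_coef_neq0 k j : sl2_coef k j != 0.
Proof. by rewrite /sl2_coef intr_eq0 mulf_neq0 //; lia. Qed.

Lemma sl2_coefS k j :
  sl2_coef k j + (4 * (k - 2) + 2)%:~R = sl2_coef (k - 2) j.+1.
Proof.
have j1 i : i.+1%:Z = i%:Z + 1 by lia.
by rewrite /sl2_coef -rmorphD /= !j1
  (_ : (j%:Z + 1) * (4 * k + 4 * j%:Z + 2) + (4 * (k - 2) + 2) = (j%:Z + 1 + 1)
    *
  (4 * (k - 2) + 4 * (j%:Z + 1) + 2)) //; ring.
Qed.

(** Applying Delta to the equation gives the same equation for Delta v in degree k - 2 with the next
    constant, which is why j is carried along. For j = 0 the left side is Delta (eta v). *)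
Lemma eta_Delta_surj N k j g : A_ k g -> iter N (@Delta C n) g = 0 ->
  exists2 v, A_ k v & eta (Delta v) + sl2_coef k j *: v = g.
Proof.
elim: N k j g => [|N IHN] k j g Ag.
  by move=> /= ->; exists 0; rewrite ?linear0 ?scaler0 ?addr0 //;
    apply/A_onsupp => a; rewrite mcoeff0 eqxx.
rewrite iterSr => /(IHN (k - 2) j.+1) [|v Av Ev]; first by apply: A_Delta;
  rewrite subrK.
have c0 := sl2_coef_neq0 k j.
have Ae : A_ k (eta v) by apply: A_eta.
have ED : Delta (g - eta v) = sl2_coef k j *: v.
  rewrite linearB /= (Delta_eta Av) -Ev -sl2_coefS scalerDl.
  by move: (_ *: v) (_ *: v) (eta _) => a b e; ring.
(* The equation is solved for its last term; here v, the solution for Delta g one step below, stands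
   for Delta of the solution sought, and [ED] confirms that it is. *)
exists ((sl2_coef k j)^-1 *: (g - eta v)).
  by apply: A_Z; apply: A_D => //; apply: A_N.
rewrite linearZ /= ED !scalerA mulVf // divff // !scale1r.
by rewrite addrC subrK.
Qed.

(** By the same passage to Delta v, induction gives Delta v = 0, and the nonzero constant then kills
    v. *)
Lemma eta_Delta_inj N k j v : A_ k v -> iter N (@Delta C n) v = 0 ->
  eta (Delta v) + sl2_coef k j *: v = 0 -> v = 0.
Proof.
elim: N k j v => [|N IHN] k j v Av // DN Ev.
suff Dv : Delta v = 0.
  move/eqP: Ev; rewrite Dv linear0 add0r scaler_eq0 (negbTE (sl2_coef_neq0 k
    j)).
  by move/eqP.
have ADv : A_ (k - 2) (Delta v) by apply: A_Delta; rewrite subrK.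
apply: (IHN (k - 2) j.+1) => //; first by rewrite -iterSr.
have := congr1 (@Delta C n) Ev;
  rewrite linear0 linearD linearZ /= (Delta_eta ADv).
by rewrite -sl2_coefS scalerDl -addrA [_ *: _ + _ *: _]addrC.
Qed.

Lemma A_decomposition k :
  direct_sum_of (@A_ C n k) (@H_ C n k) (image_of (@eta C n) (@A_ C n (k - 2))).
Proof.
have c0 : (4 * (k - 2) + 2)%:~R = sl2_coef (k - 2) 0.
  by congr (_%:~R); lia.
split=> [f|f [Af Df] [u Au Ef]].
  split=> [Af|[h [_ [[Ah _] [u Au ->] ->]]]]; last first.
    by apply: A_D => //; apply: A_eta.
  have ADf : A_ (k - 2) (Delta f) by apply: A_Delta; rewrite subrK.
  have [N DN] := Delta_nilpotent (Delta f).
  have [u Au Eu] := eta_Delta_surj 0 ADf DN.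
  exists (f - eta u), (eta u); rewrite subrK; split=> //; last by exists u.
  split; first by apply: A_D => //; apply: A_N; apply: A_eta.
  by rewrite linearB /= (Delta_eta Au) c0 Eu subrr.
have [N DN] := Delta_nilpotent u.
suff u0 : u = 0 by rewrite Ef u0 linear0.
by apply: (eta_Delta_inj (j := 0) Au DN); rewrite -c0 -(Delta_eta Au) -Ef.
Qed.

End Decomposition.

(** * Submodules, and polynomials modulo z^2 *)

Section Submodules.
Variables (C : numFieldType) (n : nat).
Local Notation poly := {mpoly C[n.*2.+1]}.
Implicit Types (i j : 'I_n) (f g u : poly) (k : int) (W : poly -> Prop).
Local Notation z := (zv C n).
Local Notation y i := (yv C i).
Local Notation w i := (wv C i).

(** By [Dop_Fop], [Dop_Dop] and [Fop_Fop], the other generators act, up to sign, as brackets of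
    these operators. *)
Lemma submodule_DF W : is_subspace W ->
  (forall i f, W f -> W (Dop i f)) -> (forall i f, W f -> W (Fop i f)) ->
  is_submodule (@so_act C n) (@so C n) W.
Proof.
move=> sW WD WF; split=> // X f soX Wf; have [W0 _] := sW.
apply: (lin_span_sub (W := fun X => W (so_act X f))) soX => [|{}X].
  split=> [|c A B WA WB]; first by rewrite so_act0.
  by rewrite so_act_lin; apply: subspaceD => //; apply: subspaceZ.
case=> [[i [j ->]]|[i [j [_ [->|->]]]]|[i [->|->]]].
- rewrite so_act_Nop scaler_nat -mulr_natl -Dop_Fop; apply: subspaceN => //.
  by apply: subspaceB => //; [apply/WD/WF | apply/WF/WD].
- by rewrite so_act_Bop -Dop_Dop; apply: subspaceB => //; do 2!apply: (WD).
- by rewrite so_act_Cop -Fop_Fop; apply: subspaceB => //; do 2!apply: (WF).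
- by rewrite so_act_Dop; apply: WD.
- by rewrite so_act_Fop; apply: subspaceN => //; apply: WF.
Qed.

Section Stable.
Variable W : poly -> Prop.
Hypothesis sW : is_submodule (@so_act C n) (@so C n) W.

Lemma submodule_Dop i f : W f -> W (Dop i f).
Proof.
move=> Wf; rewrite -so_act_Dop; apply: (proj2 sW) => //.
by apply: lin_span_gen; apply: Or33; exists i; left.
Qed.

Lemma submodule_Fop i f : W f -> W (Fop i f).
Proof.
move=> Wf; rewrite -[Fop _ _]opprK -so_act_Fop; apply: subspaceN;
  first by case: sW.
apply: (proj2 sW) => //; apply: lin_span_gen.
by apply: Or33; exists i; right.
Qed.

Lemma submodule_Nop i j f : i != j -> W f -> W (Nop i j f).
Proof.
move=> /negbTE neq_ij Wf; rewrite -[Nop _ _ _]addr0 -[0](scale0r f).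
rewrite -[0]/(false%:R) -neq_ij -[_ + _]opprK -so_act_Nop.
apply: subspaceN; first by case: sW.
apply: (proj2 sW) => //; apply: lin_span_gen.
by apply: Or31; exists i, j.
Qed.

End Stable.

Lemma H_subspace k : is_subspace (@H_ C n k).
Proof.
split=> [|c f g [Af Df] [Ag Dg]].
  by split; [case: (@A_subspace C n k) | rewrite linear0].
split; first by apply: A_D => //; apply: A_Z.
by rewrite linearP /= Df Dg scaler0 addr0.
Qed.

Lemma H_submodule k : is_submodule (@so_act C n) (@so C n) (@H_ C n k).
Proof.
apply: submodule_DF => [|i f [Af Df]|i f [Af Df]]; first exact: H_subspace.
  split; first exact: A_Dop.
  by rewrite Delta_Dop Df /Dop !(raddf0 (@dz C n), raddf0 (@dy C n i), raddf0
    (@dw C n i)) mulr0 subr0.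
split; first exact: A_Fop.
by rewrite Delta_Fop Df /Fop !(raddf0 (@dz C n)) !mulr0 addr0.
Qed.

Definition zdiv f := onsupp (fun a => 0 < a (iz n))%N f.

(** Divisibility by z^2, see [lowE]. Thus [low (f - g)] says that f and g have the same terms of
    degree at most 1 in z. *)
Definition low f := zdiv f /\ zdiv (dz f).

Lemma zdiv_zv f : zdiv (z * f).
Proof. by rewrite polyE => a; rewrite mcoeffXM; case: ifP; rewrite ?eqxx. Qed.

Lemma zdiv_mul g f : zdiv f -> zdiv (g * f).
Proof.
elim/mpolyind: g => [|c a p _ _ IHp] f0; first by rewrite mul0r => b;
  rewrite mcoeff0 eqxx.
rewrite mulrDl; apply: onsuppD; last exact: IHp.
rewrite -scalerAl; apply: onsuppZ => b; rewrite mulrC => fb.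
suff /mapP[b' b'f ->] : b \in [seq (a + m')%MM | m' <- msupp f].
  by rewrite mnmDE addn_gt0 (f0 b') ?orbT // -mcoeff_msupp.
by rewrite -(perm_mem (msuppMX f a)) mcoeff_msupp.
Qed.

Lemma zdiv_dy i f : zdiv f -> zdiv (dy i f).
Proof.
by rewrite polyE; apply: onsupp_deriv => a; rewrite mnmDE mnm1E iE addn0.
Qed.

Lemma zdiv_dw i f : zdiv f -> zdiv (dw i f).
Proof.
by rewrite polyE; apply: onsupp_deriv => a; rewrite mnmDE mnm1E iE addn0.
Qed.

Lemma zdiv_Yop f : zdiv f -> zdiv (Yop f).
Proof.
move=> f0; rewrite Yop.unlock; apply: onsupp_sum => i _ _.
by apply: zdiv_mul; apply: zdiv_dw.
Qed.

Lemma lowE f : low f <-> onsupp (fun a => 1 < a (iz n))%N f.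
Proof.
split=> [[f0 f1] a fa|fP].
  have a0 := f0 a fa; have Ua : (U_(iz n) <= a)%MM by rewrite lep1mP -lt0n.
  have := f1 (a - U_(iz n))%MM; rewrite polyE mcoeff_deriv submK //.
  rewrite mnmBE mnm1E eqxx subn1 prednK // mulrn_eq0 negb_or fa -lt0n a0 /=.
  by move=> /(_ isT); lia.
split; first by apply: onsuppW fP => a; lia.
by rewrite polyE; apply: onsupp_deriv fP => a; rewrite mnmDE mnm1E eqxx; lia.
Qed.

Lemma lowD f g : low f -> low g -> low (f + g).
Proof. by rewrite !lowE; apply: onsuppD. Qed.

Lemma lowN f : low f -> low (- f).
Proof. by rewrite !lowE; apply: onsuppN. Qed.

Lemma lowZ c f : low f -> low (c *: f).
Proof. by rewrite !lowE; apply: onsuppZ. Qed.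

Lemma low0 : low 0.
Proof. by rewrite lowE => a; rewrite mcoeff0 eqxx. Qed.

(* Delta f = 0 computes the coefficient of z^(e+2) in f from that of z^e. *)
Lemma Delta_low_eq0 f : Delta f = 0 -> low f -> f = 0.
Proof.
move=> Df lf; apply/mpolyP => a; rewrite mcoeff0.
move: (erefl (a (iz n))); move: {2}(a (iz n)) => e.
elim: e a f Df lf => [|e IHe] a f Df [f0 f1] ae.
  by apply/eqP; apply/contraT => /f0; rewrite ae.
have Ua : (U_(iz n) <= a)%MM by rewrite lep1mP ae.
have /eqP : (dz f)@_(a - U_(iz n))%MM = 0.
  apply: IHe; last by rewrite mnmBE mnm1E eqxx ae subn1.
    have -> : Delta (dz f) = dz (Delta f) by rewrite !Delta_Yop !opE.
    by rewrite Df (raddf0 (@dz C n)).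
  (* dz^2 f = 2 Y f is again divisible by z because Y does not touch z; hence dz f satisfies the
     same hypotheses as f. *)
  split=> //; move/eqP: Df; rewrite Delta_Yop subr_eq0 => /eqP ->.
  by apply: onsuppMn; apply: zdiv_Yop.
rewrite polyE mcoeff_deriv submK // mulrn_eq0 => /orP[//|/eqP //].
Qed.

End Submodules.

Section MonomialShifts.
Variables (C : numFieldType) (m : nat).
Implicit Types (a : 'X_{1..m}) (f : {mpoly C[m]}).

Lemma mcoeff_XMderiv_shift i j f a : (0 < a j)%N ->
  ('X_i * f^`M(j))@_(a - U_(j) + U_(i))%MM = (a j)%:R * f@_a.
Proof.
move=> aj; have Ua : (U_(j) <= a)%MM by rewrite lep1mP -lt0n.
rewrite mulrC addmC mcoeffMX mcoeff_deriv submK //.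
by rewrite mnmBE mnm1E eqxx subn1 prednK // mulr_natl.
Qed.

Lemma mcoeffXM_eq0 i f a : a i = 0%N -> ('X_i * f)@_a = 0.
Proof. by rewrite mcoeffXM => ->. Qed.

Lemma XM_mderivX_shift i j a :
  'X_i * ('X_[a])^`M(j) = (a j)%:R *: 'X_[C, a - U_(j) + U_(i)].
Proof. by rewrite mderivX -scalerAr mulrC -mpolyXD. Qed.

End MonomialShifts.

(** * Singular vectors *)

Section Irreducibility.
Variables (C : numFieldType) (n : nat) (l : 'I_n) (k : int).
Local Notation poly := {mpoly C[n.*2.+1]}.
Local Notation mnm := 'X_{1..n.*2.+1}.
Implicit Types (i j : 'I_n) (f g u : poly) (a b : mnm).
Local Notation z := (zv C n).
Local Notation y i := (yv C i).
Local Notation w i := (wv C i).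

(* Decreased by all Dop i and, for i != l, by Nop i l. *)
Definition level (j : 'I_(n.*2.+1)) : nat :=
  if j == iz n then 0%N else ((j != iy l) && (j != iw l)).+1.

Lemma levelE : (level (iz n) = 0%N) * (forall i, level (iy i) = (i != l).+1) *
  (forall i, level (iw i) = (i != l).+1).
Proof.
by split; [split|] => [|i|i]; rewrite /level ?eqxx ?iE //= ?andbT.
Qed.

Lemma level_Dop N i f : onsupp (fun a => wt level a < N.+1)%N f ->
  onsupp (fun a => wt level a < N)%N (Dop i f).
Proof.
move=> fN; rewrite /Dop !polyE; apply: onsuppD; last apply: onsuppN.
  apply: (@onsupp_deriv _ _ (fun a => wt level (a + U_(iz n))%MM < N.+1)%N) =>
    [a|].
    by rewrite !wtD !wtU !levelE; lia.
  by apply: onsupp_deriv fN.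
apply: (@onsuppXM _ _ (fun a => wt level (a + U_(iw i))%MM < N.+1)%N) => [a|].
  by rewrite !wtD !wtU !levelE; lia.
by apply: onsupp_deriv fN.
Qed.

Lemma level_Nop N i f : i != l -> onsupp (fun a => wt level a < N.+1)%N f ->
  onsupp (fun a => wt level a < N)%N (Nop i l f).
Proof.
move=> neq_il fN; rewrite /Nop !polyE; apply: onsuppD.
  apply: (@onsuppXM _ _ (fun a => wt level (a + U_(iy i))%MM < N.+1)%N) => [a|].
    by rewrite !wtD !wtU !levelE eqxx neq_il; lia.
  by apply: onsupp_deriv fN.
apply: (@onsuppXM _ _ (fun a => wt level (a + U_(iw i))%MM < N.+1)%N) => [a|].
  by rewrite !wtD !wtU !levelE eqxx neq_il; lia.
by apply: onsupp_deriv fN.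
Qed.

Definition singular f :=
  (forall i, Dop i f = 0) /\ (forall i, i != l -> Nop i l f = 0).

(** As long as one of the operators defining [singular] does not kill the vector, applying it gives
    a nonzero vector of W whose level bound is smaller. *)
Lemma exists_singular (W : poly -> Prop) f :
  is_submodule (@so_act C n) (@so C n) W -> W f -> f != 0 ->
  exists2 g, W g /\ g != 0 & singular g.
Proof.
move=> sW; have [N] := wt_bounded level f.
elim: N f => [|N IHN] f fN Wf f0.
  by case/eqP: f0; apply: onsupp0 => a /fN.
have [/existsP[i Df]|/existsPn D0] := boolP [exists i, Dop i f != 0].
  by apply: (IHN (Dop i f)) => //; [apply: level_Dop | apply: submodule_Dop].
have [/existsP[i /andP[il Nf]]|/existsPn N0] :=
    boolP [exists i, (i != l) && (Nop i l f != 0)].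
  by apply: (IHN (Nop i l f)) => //; [apply: level_Nop | apply: submodule_Nop].
exists f => //; split=> [i|i il]; first by apply/eqP; rewrite -[_ == _]negbK.
by have := N0 i; rewrite il negbK => /eqP.
Qed.

Definition top : mnm :=
  if 0 < k then (U_(iz n) + U_(iw l) *+ `|k - 1|)%MM else (U_(iy l) *+ `|k|)%MM.

(** In 2 sum_i y_i D_i f = 0, the term 2 z Y f equals z dz (dz f). So on dz f twice the Euler
    operator of the y_i agrees with that of z, and the two degrees are compared monomial by
    monomial. *)
Lemma singular_dz f a : (forall i, Dop i f = 0) -> Delta f = 0 ->
  (dz f)@_a != 0 -> (2 * \sum_(i < n) a (iy i) = a (iz n))%N.
Proof.
move=> Df Delf fa.
have : \sum_(i < n) y i * Dop i f = 0 by rewrite big1 // => i _;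
  rewrite Df mulr0.
have -> : \sum_(i < n) y i * Dop i f = \sum_(i < n) y i * dy i (dz f) - z * Yop
  f.
  rewrite Yop.unlock mulr_sumr -sumrB; apply: eq_bigr => i _.
  by rewrite /Dop; ring.
move/(congr1 (fun p => (p *+ 2)@_a)).
rewrite mulrnBl -mulrnAr; move/eqP: Delf; rewrite Delta_Yop subr_eq0 => /eqP <-.
move: fa; rewrite !polyE mcoeffB !mcoeffMn mcoeff_XMderiv [(\sum_(i < n)
  _)@_a](raddf_sum (mcoeff a)) /= mcoeff0 mul0rn.
under eq_bigr do rewrite mcoeff_XMderiv.
rewrite -mulr_suml -mulrnAl -mulrBl -natr_sum -mulr_natl -natrM => fa /eqP.
by rewrite mulf_eq0 (negbTE fa) orbF subr_eq0 eqr_nat => /eqP.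
Qed.

(** [singular_dz] removes the y_i from terms of degree 1 in z, and together with D_i f = 0 the w_i
    from those of degree 0. The operators N_il then leave only the index l, and the grade fixes the
    exponent. *)
Lemma singular_supp f a : H_ k f -> singular f -> f@_a != 0 ->
  (a (iz n) <= 1)%N -> a = top.
Proof.
move=> [/A_onsupp Af Delf] [Df Nf] fa az.
have dzf := singular_dz Df Delf.
have ga := Af a fa.
have sum1 (F : 'I_n -> int) : (forall i, i != l -> F i = 0) -> \sum_i F i = F l.
  by move=> F0; rewrite (bigD1 l) //= big1 ?addr0.
have [az1|az0] : a (iz n) = 1%N \/ a (iz n) = 0%N by lia.
- have Ua : (U_(iz n) <= a)%MM by rewrite lep1mP az1.
  have ay i : a (iy i) = 0%N.
    have /dzf : (dz f)@_(a - U_(iz n))%MM != 0.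
      by rewrite polyE mcoeff_deriv submK // mulrn_eq0 negb_or fa.
    rewrite mnmBE mnm1E eqxx az1 /= => /eqP; rewrite muln_eq0 /= sum_nat_eq0.
    by move=> /forallP/(_ i)/eqP; rewrite mnmBE mnm1E iE subn0.
  have aw i : i != l -> a (iw i) = 0%N.
    move=> il; apply/eqP; rewrite -leqn0 leqNgt; apply/negP => awi.
    have := congr1 (mcoeff (a - U_(iw i) + U_(iw l))%MM) (Nf i il).
    rewrite /Nop !polyE mcoeffD mcoeff0 mcoeff_XMderiv_shift // mcoeffXM_eq0.
      by move/eqP; rewrite add0r mulf_eq0 (negbTE fa) orbF pnatr_eq0; lia.
    by rewrite mnmDE mnmBE !mnm1E !iE ay.
  move: ga; rewrite gradeE az1 sum1 => [ga|i il]; last by rewrite ay aw.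
  rewrite ay in ga; rewrite /top ifT; last by lia.
  apply: mnm_iP => [|i|i]; rewrite mnmDE mulmnE !mnm1E !iE ?eqxx ?ay //.
  by case: eqVneq => [<-|/eqP il] /=; [lia | rewrite aw //; apply/eqP => /esym].
- have aw i : a (iw i) = 0%N.
    apply/eqP; rewrite -leqn0 leqNgt; apply/negP => awi.
    have := congr1 (mcoeff (a - U_(iw i) + U_(iz n))%MM) (Df i).
    rewrite /Dop zv.unlock dw.unlock dy.unlock mcoeffB mcoeff0.
    rewrite mcoeff_XMderiv_shift // mcoeff_deriv.
    (* This exponent has degree 1 in z, whereas [singular_dz] requires an even degree. *)
    have -> : (dz f)@_(a - U_(iw i) + U_(iz n) + U_(iy i))%MM = 0.
      apply/eqP; apply: contraT => /dzf.
      by rewrite !(mnmDE, mnmBE, mnm1E, iE) az0 eqxx; lia.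
    move/eqP; rewrite mul0rn sub0r oppr_eq0 mulf_eq0 (negbTE fa) orbF pnatr_eq0.
    by lia.
  have ay i : i != l -> a (iy i) = 0%N.
    move=> il; apply/eqP; rewrite -leqn0 leqNgt; apply/negP => ayi.
    have := congr1 (mcoeff (a - U_(iy i) + U_(iy l))%MM) (Nf i il).
    rewrite /Nop !polyE mcoeffD mcoeff0 mcoeff_XMderiv_shift // mcoeffXM_eq0.
      by move/eqP; rewrite addr0 mulf_eq0 (negbTE fa) orbF pnatr_eq0; lia.
    by rewrite mnmDE mnmBE !mnm1E !iE aw.
  move: ga; rewrite gradeE az0 sum1 => [ga|i il]; last by rewrite ay ?aw.
  rewrite aw in ga; rewrite /top ifF; last by lia.
  apply: mnm_iP => [|i|i]; rewrite mulmnE !mnm1E !iE ?eqxx ?aw //.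
  by case: eqVneq => [<-|/eqP il] /=; [lia | rewrite ay //; apply/eqP => /esym].
Qed.

End Irreducibility.

(** * Reaching all monomials of degree at most 1 in z *)

Section Generation.
Variables (C : numFieldType) (n : nat) (l : 'I_n) (k : int).
Local Notation poly := {mpoly C[n.*2.+1]}.
Local Notation mnm := 'X_{1..n.*2.+1}.
Implicit Types (i j : 'I_n) (f g u v : poly) (a b : mnm).
Local Notation z := (zv C n).
Local Notation y i := (yv C i).
Local Notation w i := (wv C i).

Variable W : poly -> Prop.
Hypothesis sW : is_submodule (@so_act C n) (@so C n) W.
Hypothesis WH : forall f, W f -> H_ k f.

(** The class of g modulo z^2 is met by W. Here g itself need not be harmonic, which allows working
    with single monomials. *)
Definition low_in g := exists2 f, W f & low (f - g).

Lemma low_in_subspace : is_subspace low_in.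
Proof.
have [[W0 WD] _] := sW; split=> [|c g g' [f Wf fg] [f' Wf' fg']].
  by exists 0; rewrite ?subr0 //; apply: low0.
exists (c *: f + f'); first exact: WD.
by rewrite opprD addrACA -scalerBr; apply: lowD => //; apply: lowZ.
Qed.

Lemma low_in_Nop i j g : i != j -> low_in g -> low_in (Nop i j g).
Proof.
move=> ij [f Wf [fg0 fg1]]; exists (Nop i j f); first exact: submodule_Nop.
have -> : Nop i j f - Nop i j g = Nop i j (f - g) by rewrite /Nop !linE; ring.
move: {f g Wf}(f - g) fg0 fg1 => h h0 h1; rewrite /Nop; split.
  by apply: onsuppD; apply: zdiv_mul; [apply: zdiv_dy | apply: zdiv_dw].
rewrite !opE -!derC.
by apply: onsuppD; apply: zdiv_mul; [apply: zdiv_dy | apply: zdiv_dw].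
Qed.

(** If f is z u modulo z^2, then in F_i f the term z y_i f is divisible by z^2, and dz f is u modulo
    z^2 because dz^2 f = 2 Y f is divisible by z. *)
Lemma low_in_wv i u : dz u = 0 -> low_in (z * u) -> low_in (w i * u).
Proof.
move=> u0 [f Wf [fg0 fg1]]; have [_ Df] := WH Wf.
exists (Fop i f); first exact: submodule_Fop.
have f0 : zdiv f by rewrite -[f](subrK (z * u)); apply: onsuppD => //;
  apply: zdiv_zv.
have {}fg1 : zdiv (dz f - u) by move: fg1; rewrite !opE u0 mulr0 addr0.
have Ef : dz (dz f) = Yop f *+ 2.
  by move/eqP: Df; rewrite Delta_Yop subr_eq0 => /eqP.
split.
  have -> : Fop i f - w i * u = z * (y i * f) + w i * (dz f - u).
    by rewrite /Fop; ring.
  by apply: onsuppD; [apply: zdiv_zv | apply: zdiv_mul].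
rewrite /Fop -mulrA !opE u0 Ef mulr0 subr0.
apply: onsuppD; last by apply: zdiv_mul; apply: onsuppMn; apply: zdiv_Yop.
by apply: onsuppD; [apply: zdiv_mul | apply: zdiv_zv].
Qed.

(** If f is a z-free u modulo z^2, then dz f is 2 z Y u modulo z^2, so F_i f is z times this
    expression. *)
Definition Gop i u := y i * u + w i * Yop u *+ 2.

Lemma low_in_Gop i u : dz u = 0 -> low_in u -> low_in (z * Gop i u).
Proof.
move=> u0 [f Wf [fg0 fg1]]; have [_ Df] := WH Wf.
exists (Fop i f); first exact: submodule_Fop.
have {}fg1 : zdiv (dz f) by move: fg1; rewrite !opE u0 subr0.
have Ef : dz (dz f) = Yop f *+ 2.
  by move/eqP: Df; rewrite Delta_Yop subr_eq0 => /eqP.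
split.
  have -> : Fop i f - z * Gop i u = z * (y i * f - Gop i u) + w i * dz f.
    by rewrite /Fop; ring.
  by apply: onsuppD; [apply: zdiv_zv | apply: zdiv_mul].
have -> : dz (Fop i f - z * Gop i u) =
    y i * (f - u) + w i * Yop (f - u) *+ 2 + z * (y i * dz f).
  rewrite /Fop /Gop -mulrA !opE Ef u0 (raddf0 (@Yop C n)); ring.
apply: onsuppD; last exact: zdiv_zv.
apply: onsuppD; first exact: zdiv_mul.
by apply: onsuppMn; apply: zdiv_mul; apply: zdiv_Yop.
Qed.

(** The monomials in the y_i alone, of grade at most 0, and z times those in the w_i alone, of
    positive grade. On them only one summand of [Nop] is nonzero, so it maps monomials to multiples
    of monomials. *)
Definition edge a := (a (iz n) = 0%N /\ forall i, a (iw i) = 0%N) \/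
  (a (iz n) = 1%N /\ forall i, a (iy i) = 0%N).

Lemma edge_top a : edge a -> grade (Tset n) a = k ->
  (forall i, i != l -> a (iy i) = 0%N /\ a (iw i) = 0%N) -> a = top l k.
Proof.
have sum1 (F : 'I_n -> int) : (forall i, i != l -> F i = 0) -> \sum_i F i = F l.
  by move=> F0; rewrite (bigD1 l) //= big1 ?addr0.
move=> ea + a0; rewrite gradeE sum1 => [|i /a0[-> ->] //].
rewrite /top; case: ea => -[az aE]; rewrite az aE => ga;
  [rewrite ifF | rewrite ifT];
  try lia.
  apply: mnm_iP => [|i|i]; rewrite mulmnE !mnm1E !iE ?az ?aE //.
  by case: eqVneq => [<-|il] /=; [lia | case: (a0 i) => [|e1 e2];
    rewrite ?e1 ?e2 // eq_sym].
apply: mnm_iP => [|i|i]; rewrite mnmDE mulmnE !mnm1E !iE ?eqxx ?az ?aE //.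
by case: eqVneq => [<-|il] /=; [lia | case: (a0 i) => [|e1 e2];
  rewrite ?e1 ?e2 // eq_sym].
Qed.

Hypothesis Wtop : low_in 'X_[top l k].

Lemma submU (i : 'I_(n.*2.+1)) a : (0 < a i)%N -> (a - U_(i) + U_(i))%MM = a.
Proof. by move=> ai; rewrite submK // lep1mP -lt0n. Qed.

Lemma Nop_mono i j b : Nop j i 'X_[C, b] =
  (b (iy j))%:R *: 'X_[b - U_(iy j) + U_(iy i)] +
  (b (iw j))%:R *: 'X_[b - U_(iw j) + U_(iw i)].
Proof. by rewrite /Nop !polyE !XM_mderivX_shift. Qed.

(** Moving one unit of a from an index i other than l to l gives an edge exponent b of smaller
    level, and N_li maps the monomial of b to a positive multiple of that of a. *)
Lemma low_in_edge a : edge a -> grade (Tset n) a = k -> low_in 'X_[a].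
Proof.
have [N] := ubnP (wt (level l) a); elim: N a => // N IHN a;
  rewrite ltnS => aN ea ga.
have sP := low_in_subspace.
have [/existsP[i /andP[il ai]]|/existsPn a0] :=
    boolP [exists i, (i != l) && (0 < a (iy i) + a (iw i))%N]; last first.
  by rewrite (edge_top ea ga) // => i il; have := a0 i; rewrite il /=; lia.
have li : l != i by rewrite eq_sym.
have [ayi|ayi] := posnP (a (iy i)).
  have awi : (0 < a (iw i))%N by lia.
  pose b := (a - U_(iw i) + U_(iw l))%MM.
  have Eb : (b + U_(iw i) = a + U_(iw l))%MM.
    by rewrite /b addmC addmA [(_ + (a - _))%MM]addmC submU.
  have [az aE] : a (iz n) = 1%N /\ forall j, a (iy j) = 0%N.
    by case: ea => -[az aE] //; rewrite aE in awi.
  have eb : edge b.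
    by right; split=> [|j]; rewrite mnmDE mnmBE !mnm1E !iE ?az ?aE.
  have gb : grade (Tset n) b = k.
    by have := gradeD b U_(iw i)%MM; rewrite Eb gradeD !gradeU ga => /addIr.
  have bN : (wt (level l) b < N)%N.
    have := congr1 (wt (level l)) Eb.
    by rewrite !wtD !wtU !levelE eqxx il /=; lia.
  have := low_in_Nop li (IHN b bN eb gb).
  rewrite Nop_mono (_ : b (iy l) = 0%N) ?scale0r ?add0r; last first.
    by rewrite mnmDE mnmBE !mnm1E !iE aE.
  move/(subspaceZ (b (iw l))%:R^-1 sP); rewrite scalerA mulVf ?scale1r.
    by rewrite /b addmK submU.
  by rewrite pnatr_eq0 mnmDE mnm1E eqxx addn1.
pose b := (a - U_(iy i) + U_(iy l))%MM.
have Eb : (b + U_(iy i) = a + U_(iy l))%MM.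
  by rewrite /b addmC addmA [(_ + (a - _))%MM]addmC submU.
have [az aE] : a (iz n) = 0%N /\ forall j, a (iw j) = 0%N.
  by case: ea => -[az aE] //; rewrite aE in ayi.
have eb : edge b.
  by left; split=> [|j]; rewrite mnmDE mnmBE !mnm1E !iE ?az ?aE.
have gb : grade (Tset n) b = k.
  by have := gradeD b U_(iy i)%MM; rewrite Eb gradeD !gradeU ga => /addIr.
have bN : (wt (level l) b < N)%N.
  have := congr1 (wt (level l)) Eb.
  by rewrite !wtD !wtU !levelE eqxx il /=; lia.
have := low_in_Nop li (IHN b bN eb gb).
rewrite Nop_mono (_ : b (iw l) = 0%N) ?scale0r ?addr0; last first.
  by rewrite mnmDE mnmBE !mnm1E !iE aE.
move/(subspaceZ (b (iy l))%:R^-1 sP); rewrite scalerA mulVf ?scale1r.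
  by rewrite /b addmK submU.
by rewrite pnatr_eq0 mnmDE mnm1E eqxx addn1.
Qed.

Lemma low_in_supp (P : mnm -> Prop) u :
  (forall a, P a -> low_in 'X_[a]) -> onsupp P u -> low_in u.
Proof.
have sP := low_in_subspace.
move=> PX Pu; rewrite [u]mpolyE; apply: (subspace_sum sP) => a au _.
by apply: (subspaceZ _ sP); apply: PX; apply: Pu; rewrite -mcoeff_msupp.
Qed.

(* The two sums of Gop's lie in the span of v and of Xop (Yop v); this
   combination eliminates the latter. *)
Lemma Gop_sum v (p b : nat) :
  \sum_(i < n) y i * dy i v = p%:R * v -> \sum_(i < n) w i * dw i v = b%:R * v
    ->
  (2 * b%:R - 1) * \sum_(i < n) Gop i (dy i v)
    - 2 * \sum_(i < n) Gop i (Xop (dw i v)) = - ((p * (2 * b + 1))%:R * v).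
Proof.
move=> Ey Ew.
have YX : Yop (Xop v) = Xop (Yop v) + (p%:R - b%:R) * v.
  by rewrite Yop_Xop sumrB Ey Ew mulrBl.
have XY : \sum_(i < n) w i * dy i (Yop v) = Xop (Yop v) by rewrite [RHS]XopE.
have YY : \sum_(i < n) y i * dw i v = Yop v by rewrite [RHS]YopE.
have -> : \sum_(i < n) Gop i (dy i v) =
    \sum_(i < n) y i * dy i v +
    (\sum_(i < n) w i * dy i (Yop v) - \sum_(i < n) w i * dw i v) *+ 2.
  rewrite -sumrB -sumrMnl -big_split; apply: eq_bigr => i _ /=.
  by rewrite /Gop !opE; ring.
have -> : \sum_(i < n) Gop i (Xop (dw i v)) =
    (Yop (Xop (\sum_(i < n) w i * dw i v))) *+ 2
    - (Xop (\sum_(i < n) y i * dw i v) - \sum_(i < n) w i * dw i v).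
  rewrite !(raddf_sum (@Xop C n)) (raddf_sum (@Yop C n)) -sumrMnl -!sumrB;
    apply: eq_bigr => i _ /=.
  by rewrite /Gop !opE; ring.
by rewrite XY Ey Ew YY !opE YX natrM natrD natrM; ring.
Qed.

(** Induction on the degree in the y_i and w_i. Off the edge, a monomial w_i u comes from z u. For z
    v with some y_i dividing v, the polynomials dy_j v and X (dw_j v) are z-free, of grade k and
    smaller degree; [Gop_sum] recovers z v from their images, as its constant p (2 q + 1) is then
    nonzero. *)
Lemma low_in_mono a : grade (Tset n) a = k -> (a (iz n) <= 1)%N -> low_in
  'X_[a].
Proof.
have sP := low_in_subspace.
pose d (j : 'I_(n.*2.+1)) : nat := j != iz n.
have [N] := ubnP (wt d a); elim: N a => // N IHN a; rewrite ltnS => aN ga az.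
have IH u : onsupp (fun b => [/\ grade (Tset n) b = k, (b (iz n) <= 1)%N & (wt
  d b < N)%N]) u ->
  low_in u by apply: low_in_supp => b [] *; apply: IHN.
have [az0|az1] : a (iz n) = 0%N \/ a (iz n) = 1%N by lia.
  have [/existsP[i ai]|/existsPn a0] := boolP [exists i, 0 < a (iw i)]%N;
    last first.
    by apply: low_in_edge ga => //; left; split=> // i; have := a0 i; lia.
  pose u := 'X_[C, a - U_(iw i)].
  have -> : 'X_[a] = w i * u by rewrite polyE -mpolyXD addmC submU.
  apply: low_in_wv; first by rewrite polyE mderivX mnmBE az0 scale0r.
  rewrite zv.unlock -mpolyXD; apply: IH; apply: onsuppX.
  have Ea := submU ai; split.
  - by move: ga; rewrite -{1}Ea !gradeD !gradeU addrC.
  - by rewrite mnmDE mnmBE az0 mnm1E eqxx.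
  - by move: aN; rewrite -{1}Ea !wtD !wtU /d !iE eqxx; lia.
have [/existsP[i ai]|/existsPn a0] := boolP [exists i, 0 < a (iy i)]%N;
  last first.
  by apply: low_in_edge ga => //; right; split=> // i; have := a0 i; lia.
have Ea : (a - U_(iz n) + U_(iz n))%MM = a by apply: submU; rewrite az1.
set b := (a - U_(iz n))%MM in Ea.
have bz : b (iz n) = 0%N by rewrite mnmBE az1 mnm1E eqxx.
have gb : grade (Tset n) b + 1 = k by rewrite -ga -Ea gradeD gradeU.
have bN : (wt d b <= N)%N by move: aN; rewrite -Ea wtD; lia.
set v := 'X_[C, b].
have -> : 'X_[a] = z * v by rewrite polyE -mpolyXD addmC Ea.
have Av : onsupp (fun c => [/\ grade (Tset n) c + 1 = k, c (iz n) = 0%N & (wt d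
  c <= N)%N]) v.
  exact: onsuppX.
have low1 j : low_in (dy j v).
  apply: IH; rewrite polyE; apply: onsupp_deriv Av => c.
  by rewrite gradeD gradeU mnmDE mnm1E !iE wtD wtU /d iE subrK; case=> *;
    split; lia.
have low2 j : low_in (Xop (dw j v)).
  apply: IH; rewrite Xop.unlock; apply: onsupp_sum => j' _ _; rewrite !polyE.
  apply: (@onsuppXM _ _ (fun c => [/\ grade (Tset n) (c + U_(iy j') + U_(iw
    j))%MM + 1 = k,
     (c + U_(iy j') + U_(iw j))%MM (iz n) = 0%N & (wt d (c + U_(iy j') + U_(iw
       j))%MM <= N)%N])) => [c|].
    rewrite !gradeD !gradeU !mnmDE !mnm1E !iE !wtD !wtU /d !iE; case=> *;
      split; lia.
  apply: (@onsupp_deriv _ _ (fun c => [/\ grade (Tset n) (c + U_(iw j))%MM + 1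
    = k,
     (c + U_(iw j))%MM (iz n) = 0%N & (wt d (c + U_(iw j))%MM <= N)%N])) => //.
  by apply: onsupp_deriv Av.
have dzv : dz v = 0 by rewrite polyE mderivX bz scale0r.
pose p := (\sum_(j < n) b (iy j))%N; pose q := (\sum_(j < n) b (iw j))%N.
have Ep : \sum_(j < n) y j * dy j v = p%:R * v.
  rewrite !polyE; under eq_bigr do rewrite XM_mderivX.
  by rewrite -scaler_suml -natr_sum scaler_nat mulr_natl.
have Eq : \sum_(j < n) w j * dw j v = q%:R * v.
  rewrite !polyE; under eq_bigr do rewrite XM_mderivX.
  by rewrite -scaler_suml -natr_sum scaler_nat mulr_natl.
have p0 : (0 < p)%N.
  rewrite /p (bigD1 i) //= mnmBE mnm1E iE; lia.
have := Gop_sum Ep Eq; set S1 := \sum_(j < n) _; set S2 := \sum_(j < n) _ => ES.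
have low_S1 : low_in (z * S1).
  rewrite mulr_sumr; apply: (subspace_sum sP) => j _ _.
  by apply: low_in_Gop => //; rewrite -derC dzv (raddf0 (@dy C n j)).
have low_S2 : low_in (z * S2).
  rewrite mulr_sumr; apply: (subspace_sum sP) => j _ _.
  apply: low_in_Gop => //.
  by rewrite derXop -derC dzv (raddf0 (@dw C n j)) (raddf0 (@Xop C n)).
pose r := (p * (2 * q + 1))%N.
have r0 : r%:R != 0 :> C by rewrite pnatr_eq0 /r; lia.
have low_T : low_in ((2 * q)%:R *: (z * S1) - z * S1 - 2%:R *: (z * S2)).
  by apply: (subspaceB sP); [apply: (subspaceB sP)|] => //;
    apply: (subspaceZ _ sP).
rewrite -[z * v]scale1r -(mulVf r0) -scalerA; apply: (subspaceZ _ sP).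
rewrite -[_ *: _]opprK; apply: (subspaceN sP); move: low_T.
suff -> : (2 * q)%:R *: (z * S1) - z * S1 - 2%:R *: (z * S2) = - (r%:R *: (z *
  v)) by [].
transitivity (z * ((2 * q%:R - 1) * S1 - 2 * S2)).
  by rewrite !scaler_nat; ring.
by rewrite ES mulrN mulr_natl mulrnAr scaler_nat.
Qed.

Lemma H_sub_low_in h : H_ k h -> W h.
Proof.
move=> [/A_onsupp Ah Dh].
have [f Wf lf] : low_in h.
  have sP := low_in_subspace.
  rewrite [h]mpolyE (bigID (fun a : mnm => a (iz n) <= 1)%N) /=.
  apply: (subspaceD sP); apply: (subspace_sum sP) => a ah az.
    apply: (subspaceZ _ sP); apply: low_in_mono => //.
    by apply: Ah; rewrite -mcoeff_msupp.
  (* Monomials of degree at least 2 in z have class zero. *)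
  apply: (subspaceZ _ sP); exists 0; first by case: sW => -[].
  rewrite sub0r; apply: lowN; apply/lowE; apply: onsuppX; lia.
have [_ Df] := WH Wf.
suff : f - h = 0 by move/subr0_eq <-.
by apply: Delta_low_eq0 => //; rewrite linearB /= Df Dh subr0.
Qed.

End Generation.

(** * Irreducibility and cyclicity *)

Section Irreducible.
Variables (C : numFieldType) (n : nat) (l : 'I_n) (k : int).
Local Notation poly := {mpoly C[n.*2.+1]}.

(** A singular vector of W is a multiple of the monomial [top l k] modulo z^2; the factor is
    nonzero, since otherwise the vector would be harmonic and divisible by z^2. This starts the
    generation. *)
Lemma H_simple (W : poly -> Prop) : is_submodule (@so_act C n) (@so C n) W ->
  (forall f, W f -> H_ k f) -> (exists2 f, W f & f != 0) ->
  forall h, H_ k h -> W h.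
Proof.
move=> sW WH [f0 Wf0 f0N0].
have [f [Wf fN0] sf] := exists_singular l sW Wf0 f0N0.
have [Af Df] := WH _ Wf.
have lf : low (f - f@_(top l k) *: 'X_[top l k]).
  apply/lowE => a; rewrite mcoeffB mcoeffZ mcoeffX ltnNge => fa.
  apply/negP => az; move: fa; have [<-|neq_a] := eqVneq (top l k) a.
    by rewrite mulr1 subrr eqxx.
  rewrite mulr0 subr0 => fa; case/eqP: neq_a.
  by rewrite (singular_supp (conj Af Df) sf fa az).
have c0 : f@_(top l k) != 0.
  apply: contraNneq fN0 => c0; apply/eqP; apply: Delta_low_eq0 => //.
  by rewrite -[f]subr0 -(scale0r 'X_[top l k]) -{1}c0.
apply: (@H_sub_low_in C n l k W sW WH).
exists ((f@_(top l k))^-1 *: f); first by apply: subspaceZ => //; case: sW.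
rewrite (_ : _ - _ = (f@_(top l k))^-1 *: (f - f@_(top l k) *: 'X_[top l k])).
  exact: lowZ.
by rewrite scalerBr scalerA mulVf // scale1r.
Qed.

Lemma H_irreducible (v : poly) : H_ k v -> v != 0 ->
  is_irreducible (@so_act C n) (@so C n) (@H_ C n k).
Proof.
move=> Hv v0; split; [exact: H_submodule | by exists v |].
move=> W sW WH; have [Wf|W0] := boolp.EM (exists2 f, W f & f != 0).
  by right=> h; apply: H_simple.
left=> f Wf; apply/eqP; apply: contraT => f0; case: W0; exists f => //.
Qed.

Lemma H_highest_weight (Hc Hp : 'M[C]_(n.*2.+1) -> Prop) lam (v : poly) : H_ k
  v ->
  is_highest_weight_vector (@so_act C n) Hc Hp lam v ->
  is_highest_weight_module (@so_act C n) (@so C n) Hc Hp (@H_ C n k) lam v.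
Proof.
move=> Hv hv; split=> //; first exact: H_submodule.
(* A submodule containing v may stick out of H_k, so it is replaced by its intersection with H_k. *)
move=> W sW Wv u Hu; pose WI f := W f /\ H_ k f.
suff [] : WI u by [].
have sH := @H_submodule C n k.
apply: (H_simple (W := WI)) => //; [|by move=> f []|by exists v; [|case: hv]].
split; first split; first by split; [case: sW => -[] | case: sH => -[]].
  move=> c f g [Wf Hf] [Wg Hg]; split.
    by case: sW => -[_ WD] _; apply: WD.
  by case: sH => -[_ HD] _; apply: HD.
by move=> X f soX [Wf Hf]; split; [apply: (proj2 sW) | apply: (proj2 sH)].
Qed.

End Irreducible.

(** * Shifting one summation index *)

Section CyclicSum.
Variables (V : nmodType) (n N : nat) (i : 'I_n) (F : ('I_n -> nat) -> V).

(** The shift of r_i is made cyclic, hence a bijection of the index set. The only mismatch is the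
    wrap from N to 0, where both terms vanish. F takes functions into nat so that the value N + 1
    makes sense. *)
Lemma sum_shift_coord :
  (forall r, r i = 0%N -> F r = 0) -> (forall r, r i = N.+1 -> F r = 0) ->
  \sum_(r : {ffun 'I_n -> 'I_N.+1}) F (fun j => r j) =
  \sum_(r : {ffun 'I_n -> 'I_N.+1}) F (fun j => r j + (j == i))%N.
Proof.
move=> F0 FN.
pose h (s : 'I_N.+1 -> 'I_N.+1) (r : {ffun 'I_n -> 'I_N.+1}) :=
  [ffun j => if j == i then s (r j) else r j].
have hK s s' : cancel s s' -> cancel (h s) (h s').
  by move=> sK r; apply/ffunP => j; rewrite !ffunE; case: eqP => // _;
    rewrite sK.
rewrite (reindex (h (@ordS _))); last first.
  by exists (h (@ord_pred _)) => r _; apply: hK;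
    [exact: ordSK | exact: ord_predK].
apply: eq_bigr => r _; have [lt_ri|ge_ri] := ltnP (r i) N.
  congr F; apply: boolp.funext => j; rewrite ffunE.
  case: eqP => [->|_]; last by rewrite addn0.
  by rewrite /= modn_small ?addn1.
have ri : r i = N :> nat by apply/eqP; rewrite eqn_leq ge_ri -ltnS ltn_ord.
rewrite F0 ?FN ?eqxx ?ri ?addn1 //.
by rewrite ffunE eqxx /= ri modnn.
Qed.

End CyclicSum.

(** * The harmonic polynomials with prescribed terms of degree at most 1 in z *)

Section Basis.
Variables (C : numFieldType) (n : nat).
Local Notation poly := {mpoly C[n.*2.+1]}.
Local Notation mnm := 'X_{1..n.*2.+1}.
Implicit Types (i j : 'I_n) (f g u : poly) (a b : mnm) (r : 'I_n -> nat).
Local Notation z := (zv C n).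
Local Notation y i := (yv C i).
Local Notation w i := (wv C i).

Definition mono (e : nat) (s t : 'I_n -> nat) : mnm :=
  (U_(iz n) *+ e + \sum_(i < n) (U_(iy i) *+ s i + U_(iw i) *+ t i))%MM.

Lemma monoE e s t : (mono e s t (iz n) = e) *
  (forall i, mono e s t (iy i) = s i) * (forall i, mono e s t (iw i) = t i).
Proof.
split; [split|] => [|i|i]; rewrite mnmDE mnm_sumE mulmnE mnm1E ?iE ?eqxx ?mul1n.
- by rewrite big1 ?addn0 // => i _; rewrite mnmDE !mulmnE !mnm1E !iE.
- rewrite (bigD1 i) //= big1 => [|j ji]; rewrite mnmDE !mulmnE !mnm1E !iE.
    by rewrite eqxx mul1n !addn0.
  by rewrite (negbTE ji).
- rewrite (bigD1 i) //= big1 => [|j ji]; rewrite mnmDE !mulmnE !mnm1E !iE.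
    by rewrite eqxx mul1n !addn0.
  by rewrite (negbTE ji).
Qed.

Lemma mpolyX_mono e s t : 'X_[C, mono e s t] =
  z ^+ e * \prod_(i < n) (y i ^+ s i * w i ^+ t i).
Proof.
rewrite mpolyXD polyE mpolyXn; congr (_ * _).
rewrite (big_morph _ (@mpolyXD _ _) (@mpolyX0 _ _)); apply: eq_bigr => i _.
by rewrite !polyE !mpolyXn mpolyXD.
Qed.

Variables (a : mnm).
Local Notation eps := (a (iz n)).
Hypothesis eps1 : (eps <= 1)%N.

Definition basis_coef r : C := let R := (\sum_(i < n) r i)%N in
  (2 ^ R * eps`! * R`! * \prod_(i < n) 'C(a (iw i), r i))%:R / ((eps + 2 *
    R)`!)%:R.

Definition basis_exp r : mnm :=
  mono (eps + 2 * \sum_(i < n) r i) (fun i => a (iy i) + r i)%N (fun i => a (iw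
    i) - r i)%N.

Lemma basis_polyE : basis_poly C a =
  \sum_(r : {ffun 'I_n -> 'I_(\max_(i < n) a (iw i)).+1})
     basis_coef (fun i => r i) *: 'X_[basis_exp (fun i => r i)].
Proof.
rewrite /basis_poly.
have Ew i : ix n (n + i.+2) = iw i by rewrite ix_fold.
have Ey i : ix n i.+2 = iy i by rewrite ix_fold.
rewrite (eq_bigr _ (fun i _ => congr1 a (Ew i))) (@ix_fold n).1.1.
apply: eq_bigr => r _; rewrite /basis_exp mpolyX_mono polyE;
  congr (_ *: (_ * _)).
  rewrite /basis_coef; congr (_%:R / _); congr (_ * _)%N.
  by apply: eq_bigr => i _; rewrite Ew.
by apply: eq_bigr => i _; rewrite Ew Ey !polyE.
Qed.

(** What dz^2 leaves of [basis_coef] once the factor R of R! is set aside; that factor is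
    distributed over the coordinates as the r_i of [red_term]. *)
Definition red_coef r : C := let R := (\sum_(i < n) r i)%N in
  (2 ^ R * eps`! * R.-1`! * \prod_(i < n) 'C(a (iw i), r i))%:R /
  ((eps + 2 * R.-1)`!)%:R.

Definition red_exp r : mnm :=
  mono (eps + 2 * (\sum_(i < n) r i).-1) (fun i => a (iy i) + r i)%N
    (fun i => a (iw i) - r i)%N.

(* dz^2 maps the r-th term of basis_poly to the sum of the red_term i r, and
   2 Yop maps it to the sum of the red_term i (r + e_i), so that Delta
   telescopes along each coordinate. *)
Definition red_term i r : poly := ((r i)%:R * red_coef r) *: 'X_[red_exp r].

Lemma factr_neq0 m : m`!%:R != 0 :> C.
Proof. by rewrite pnatr_eq0 -lt0n fact_gt0. Qed.

Lemma dzz_basis_term r : dz (dz (basis_coef r *: 'X_[basis_exp r])) =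
  \sum_(i < n) red_term i r.
Proof.
rewrite -scaler_suml -mulr_suml -natr_sum !linearZ /= polyE mderivX mderivZ
  mderivX.
rewrite mnmBE mnm1E eqxx !monoE !scalerA.
rewrite /basis_coef /red_coef /basis_exp /red_exp.
case ER : (\sum_(i < n) r i)%N => [|R].
  (* For R = 0, the case where [R.-1] is a default value, dz^2 kills the term since eps is at most
     1. *)
  have e0 : (eps * (eps - true) = 0)%N by case: eps eps1 => [|[|]].
  transitivity (0 : poly); apply/eqP;
    last by rewrite eq_sym scaler_eq0 mulf_eq0 eqxx.
  by rewrite muln0 addn0 -natrM e0 scaler_eq0 !mulf_eq0 eqxx !orbT.
rewrite (_ : _ - _ - _ = red_exp r)%MM; last first.
  rewrite /red_exp ER; apply: mnm_iP => [|i|i];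
    rewrite !mnmBE !mnm1E !monoE ?iE ?eqxx ?subn0 //=; lia.
rewrite /red_exp ER /=; congr (_ *: _).
rewrite (_ : eps + 2 * R.+1 = (eps + 2 * R).+2)%N; last by lia.
rewrite subn1 /= !factS !natrM.
have := factr_neq0 (eps + 2 * R);
  have : (eps + 2 * R).+2%:R != 0 :> C by rewrite pnatr_eq0.
have : (eps + 2 * R).+1%:R != 0 :> C by rewrite pnatr_eq0.
move: (_.+1%:R) (_.+2%:R) (_`!%:R) (_`!%:R) (_`!%:R) (\prod_(_ < _) _)%:R => /=
  ? ? ? ? ? ? p0 q0 r0.
by field; rewrite p0 q0 r0.
Qed.

Lemma Yop_basis_term r : Yop (basis_coef r *: 'X_[basis_exp r]) *+ 2 =
  \sum_(i < n) red_term i (fun j => r j + (j == i))%N.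
Proof.
rewrite linearZ /= YopE scaler_sumr -sumrMnl; apply: eq_bigr => i _.
rewrite !polyE XM_mderivX_shift monoE -scaler_nat !scalerA /red_term.
have ER : (\sum_(j < n) (r j + (j == i)) = (\sum_(j < n) r j).+1)%N.
  rewrite big_split (bigD1 i (F := fun j => nat_of_bool (j == i))) //= eqxx.
  by rewrite [X in (_ + (1 + X))%N]big1 ?addn1 // => j /negbTE ->.
rewrite (_ : _ - _ + _ = red_exp (fun j => r j + (j == i))%N)%MM; last first.
  rewrite /red_exp ER; apply: mnm_iP => [|j|j];
    rewrite !monoE !mnmDE !mnmBE !mnm1E !monoE ?iE ?subn0 ?addn0 //=;
      by rewrite ?[i == _]eq_sym ?addnA ?subnDA.
congr (_ *: _); rewrite /basis_coef /red_coef ER /= eqxx.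
set b := (\sum_(j < n) r j)%N.
(* The exponent of w_i brought down by Y is absorbed into the i-th binomial. *)
have EC : ((r i + 1) * \prod_(j < n) 'C(a (iw j), r j + (j == i)) =
    (a (iw i) - r i) * \prod_(j < n) 'C(a (iw j), r j))%N.
  rewrite (bigD1 i) //= [in RHS](bigD1 i) //= !mulnA eqxx !addn1 mul_bin_left.
  congr (_ * _)%N; apply: eq_bigr => j /negbTE ->.
  by rewrite addn0.
have := congr1 (fun m => m%:R : C) EC; rewrite /= !natrM => {}EC.
rewrite expnS !natrM.
have := factr_neq0 (eps + 2 * b); move: EC.
rewrite -[(r i + true)%N]/(r i + 1)%N.
move: (r i + 1)%:R (\prod_(j < n) _)%:R (\prod_(j < n) _)%:R (_ - _)%:R (2 ^
  b)%:R.
move: (_`!%:R) (_`!%:R) (_`!%:R) => f1 f2 f3 s P' P D T EC f30.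
transitivity (2 * T * f1 * f2 * (D * P') / f3); first by field.
by rewrite -EC; field.
Qed.

Lemma red_term_eq0 i r :
  r i = 0%N \/ r i = (\max_(j < n) a (iw j)).+1 -> red_term i r = 0.
Proof.
case=> ri; first by rewrite /red_term ri mul0r scale0r.
rewrite /red_term /red_coef [(\prod_(_ < _) _)%N](bigD1 i) //= bin_small ?mul0n
  ?muln0 ?mul0r ?mulr0 ?scale0r //.
by rewrite ri ltnS; apply: leq_bigmax.
Qed.

Lemma Delta_basis_poly : Delta (basis_poly C a) = 0.
Proof.
rewrite basis_polyE Delta_Yop !linear_sum /= -sumrMnl.
under eq_bigr do rewrite dzz_basis_term.
under [X in _ - X]eq_bigr do rewrite Yop_basis_term.
rewrite exchange_big [X in _ - X]exchange_big /= -sumrB big1 // => i _.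
apply/eqP; rewrite subr_eq0; apply/eqP; apply: sum_shift_coord => r ri;
  by apply: red_term_eq0; auto.
Qed.

(** The term r = 0 is the monomial itself, and each other term carries z^2. *)
Lemma low_basis_poly : low (basis_poly C a - 'X_[a]).
Proof.
rewrite basis_polyE (bigD1 [ffun=> ord0]) //= addrAC; apply: lowD.
  rewrite (_ : _ - _ = 0); first exact: low0.
  have R0 : (\sum_(i < n) ([ffun=> ord0] : {ffun 'I_n -> 'I_(\max_(i < n) a (iw
    i)).+1}) i = 0)%N.
    by rewrite big1 // => i _; rewrite ffunE.
  rewrite /basis_coef /basis_exp R0 addn0 expn0 mul1n muln1 [(\prod_(_ < _)
    _)%N]big1; last first.
    by move=> i _; rewrite ffunE bin0.
  rewrite muln1 divff ?factr_neq0 // scale1r (_ : mono _ _ _ = a) ?subrr //.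
  by apply: mnm_iP => [|i|i]; rewrite monoE ?ffunE ?addn0 ?subn0.
apply/lowE; apply: onsupp_sum => r _ r0; apply: onsuppZ; apply: onsuppX.
rewrite monoE; set s := bigop _ _ _; suff : (0 < s)%N by clearbody s; lia.
rewrite /s lt0n sum_nat_eq0; apply: contra r0 => /forallP r0.
apply/eqP/ffunP => i; rewrite ffunE; apply: val_inj; exact/eqP/r0.
Qed.

Lemma A_basis_poly : A_ (grade (Tset n) a) (basis_poly C a).
Proof.
rewrite basis_polyE; apply/A_onsupp; apply: onsupp_sum => r _ _.
(* Where the subtraction in the exponent of w_i is truncated, the grade would be wrong, but a
   binomial vanishes. *)
have [/existsP[i ri]|/existsPn ler] := boolP [exists i, a (iw i) < r i]%N.
  rewrite /basis_coef [(\prod_(_ < _) _)%N](bigD1 i) //= bin_small // mul0n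
    muln0 mul0r scale0r.
  by move=> b; rewrite mcoeff0 eqxx.
apply: onsuppZ; apply: onsuppX; rewrite /basis_exp !gradeE monoE.
rewrite PoszD -addrA; congr (_ + _).
rewrite mul2n -addnn -big_split (big_morph Posz PoszD (erefl _)) -big_split.
apply: eq_bigr => i _; rewrite !monoE -subzn; last by rewrite leqNgt;
  apply: ler.
by rewrite !PoszD /=; ring.
Qed.

Lemma basis_coef_low b : (b (iz n) <= 1)%N -> (basis_poly C a)@_b = (a == b)%:R.
Proof.
move=> b1; apply/eqP; rewrite -subr_eq0 -mcoeffX -mcoeffB; apply: contraT.
by have /lowE l0 := low_basis_poly => /l0; rewrite ltnNge b1.
Qed.

End Basis.

Section BasisOfH.
Variables (C : numFieldType) (n : nat) (k : int).
Local Notation mnm := 'X_{1..n.*2.+1}.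

Lemma basis_indexE (a : mnm) :
  basis_index k a <-> (a (iz n) <= 1)%N /\ grade (Tset n) a = k.
Proof.
rewrite /basis_index gradeE ix_fold.
have -> : \sum_(i < n) ((a (ix n (n + i.+2)))%:Z - (a (ix n i.+2))%:Z) =
  \sum_(i < n) ((a (iw i))%:Z - (a (iy i))%:Z) by apply: eq_bigr => i _;
    rewrite !ix_fold.
by split=> -[].
Qed.

(** By [basis_coef_low] the family is dual to the monomials of degree at most 1 in z, whence
    independence. A harmonic v and the combination with the same coefficients at these monomials are
    both harmonic and agree modulo z^2, hence are equal. *)
Lemma H_basis : is_basis (@basis_index n k) (@basis_poly C n) (@H_ C n k).
Proof.
split=> [s c us sP Es a sa|v].
  have := congr1 (mcoeff a) Es; rewrite raddf_sum mcoeff0 /= => E0.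
  have /sP/basis_indexE[az _] := sa.
  rewrite -{}E0 (bigD1_seq a) //= mcoeffZ basis_coef_low // eqxx mulr1.
  rewrite big_seq_cond big1 ?addr0 // => b /andP[/sP/basis_indexE[bz _] ba].
  by rewrite mcoeffZ basis_coef_low // (negbTE ba) mulr0.
split=> [[/A_onsupp Av Dv]|]; last first.
  apply: lin_span_sub => [|_ [a /basis_indexE[az ga] ->]];
    first exact: H_subspace.
  by split; [rewrite -ga; apply: A_basis_poly | apply: Delta_basis_poly].
have -> : v = \sum_(a <- msupp v | (a (iz n) <= 1)%N) v@_a *: basis_poly C a.
  apply/eqP; rewrite -subr_eq0; apply/eqP; apply: Delta_low_eq0.
    rewrite linearB /= Dv sub0r linear_sum /= big1 ?oppr0 // => a az.
    by rewrite linearZ /= Delta_basis_poly // scaler0.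
  rewrite {1}[v]mpolyE (bigID (fun a : mnm => a (iz n) <= 1)%N) /= addrAC;
    apply: lowD.
    rewrite -sumrB; apply/lowE; apply: onsupp_sum => a _ az; apply/lowE.
    rewrite -scalerBr -opprB scalerN; apply: lowN; apply: lowZ.
    exact: low_basis_poly.
  apply/lowE; apply: onsupp_sum => a _ az; apply: onsuppZ; apply: onsuppX.
  by rewrite ltnNge.
apply: subspace_sum => [|a av az]; first exact: lin_span_subspace.
apply: subspaceZ; first exact: lin_span_subspace.
apply: lin_span_gen; exists a => //; apply/basis_indexE; split=> //.
by apply: Av; rewrite -mcoeff_msupp.
Qed.

End BasisOfH.

(** * Highest weights *)

Section FundamentalWeightLinear.
Variables (C : numFieldType) (n : nat).

Lemma fund_weight_lin i c (A B : 'M[C]_(n.*2.+1)) :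
  fund_weight i (c *: A + B) = c * fund_weight i A + fund_weight i B.
Proof.
case: i => [|i] /=; first by rewrite mulr0 addr0.
by case: insub => [j|]; rewrite ?linearP // mulr0 addr0.
Qed.

End FundamentalWeightLinear.

Section HighestWeight.
Variables (C : numFieldType) (m : nat).
Local Notation n := m.+1.
Local Notation l := (ord_max : 'I_n).
Local Notation poly := {mpoly C[n.*2.+1]}.
Implicit Types (i j : 'I_n) (v : poly) (d : nat).

Lemma cartan_gen_last : coroot C l = 2 *: cartan_gen C l.
Proof.
have EE p q : p = q -> E C n p p = E C n q q by move=> ->.
by rewrite /coroot ltnn /cartan_gen; congr (_ *: (_ - _)); apply: EE => /=; lia.
Qed.

Lemma cartan_genS i j : j = i.+1 :> nat -> coroot C i = cartan_gen C i -
  cartan_gen C j.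
Proof.
move=> ji; rewrite /coroot -ji ltn_ord /cartan_gen ji.
by rewrite opprB addrA addrAC.
Qed.

(** Both highest weights have this one form, with d = k - 1 for k > 0 and d = -k for k <= 0. *)
Variables (d : nat) (lam : 'M[C]_(n.*2.+1) -> C).
Hypothesis lamE : forall h,
  lam h = d%:R * fund_weight m h - (2 * d.+1)%:R * fund_weight m.+1 h.

Lemma weight_lin c A B : lam (c *: A + B) = c * lam A + lam B.
Proof. by rewrite !lamE !fund_weight_lin; ring. Qed.

Lemma weight_coroot i :
  lam (coroot C i) = d%:R * (i.+1 == m :> nat)%:R - (2 * d.+1)%:R * (i == l)%:R.
Proof.
rewrite lamE -[m.+1]/(l.+1) fund_weight_coroot [l == i]eq_sym;
  congr (_ * _ - _).
(* For n = 1 the fundamental weight of index n - 1 is lambda_0 = 0. *)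
case: m i => [|m'] i; first by rewrite /= -[RHS]/0.
have lt_m : (m' < m'.+2)%N by [].
by rewrite -[m'.+1]/((Ordinal lt_m).+1) fund_weight_coroot eqSS eq_sym.
Qed.

(** The last coroot is twice the last generator, and each other generator is its coroot plus the
    next generator; the coordinates are thus computed downwards from the last index. *)
Lemma weight_cartan_gen i : lam (cartan_gen C i) = - 1 - d%:R * (i == l)%:R.
Proof.
have lamZ c A : lam (c *: A) = c * lam A.
  have l0 : lam 0 = 0.
    by have := weight_lin (-1) 0 0; rewrite scaler0 addr0 mulN1r addNr.
  by rewrite -[_ *: _]addr0 weight_lin l0 addr0.
have lam_last : lam (cartan_gen C l) = - 1 - d%:R.
  apply: (mulfI (_ : 2 != 0)); first by rewrite pnatr_eq0.
  rewrite -lamZ -cartan_gen_last weight_coroot eqxx /=.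
  by rewrite (_ : (m.+1 == m) = false) ?natrM -?[d.+1%:R]natr1 ?mulr0n;
    [ring | lia].
have [e le_e] := ubnP (m - i)%N; elim: e i le_e => // e IHe i lt_e.
have [->|il] := eqVneq i l; first by rewrite lam_last mulr1.
have lt_i : (i.+1 < n)%N by rewrite ltnS ltn_neqAle il -ltnS ltn_ord.
pose j := Ordinal lt_i.
have -> : cartan_gen C i = 1 *: coroot C i + cartan_gen C j.
  by rewrite scale1r (cartan_genS (j := j)) // subrK.
rewrite weight_lin weight_coroot IHe /=; last by lia.
rewrite (negbTE il) (_ : (j == l) = (i.+1 == m :> nat)) // mulr0n; ring.
Qed.

Variable v : poly.
Hypothesis v0 : v != 0.
Hypothesis Dv : forall i, Dop i v = 0.
Hypothesis dyv : forall i, i != l -> dy i v = 0.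
Hypothesis dwv : forall i, i != l -> dw i v = 0.
Hypothesis Nv : Nop l l v = d%:R * v.

Lemma highest_weight_vector :
  is_highest_weight_vector (@so_act C n) (@cartan C n) (@so_plus C n) lam v.
Proof.
split=> // [h|X].
  apply: (lin_span_sub (W := fun h => so_act h v = lam h *: v)) => [|_ [i ->]].
    split=> [|c A B EA EB]; first by have := weight_lin (-1) 0 0;
      rewrite so_act0 scaler0 addr0 mulN1r addNr => ->; rewrite scale0r.
    by rewrite so_act_lin EA EB weight_lin scalerDl scalerA.
  rewrite /cartan_gen so_act_Nop eqxx weight_cartan_gen mulr1n scale1r.
  have [->|il] := eqVneq i l.
    by rewrite Nv mulr1 scalerBl scaleN1r scaler_nat mulr_natl opprD addrC.
  by rewrite /Nop dyv // dwv // !mulr0 addr0 add0r subr0 scaleN1r.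
apply: (lin_span_sub (W := fun X => so_act X v = 0)) => [|{}X].
  split=> [|c A B EA EB]; first exact: so_act0.
  by rewrite so_act_lin EA EB scaler0 addr0.
case=> [[i [j [lt_ij ->]]]|[i [j [lt_ij ->]]]|[i ->]].
(* As i < j, the index i is not the last one, so [Nop i j] differentiates v only in variables that v
   does not contain. *)
- have il : i != l by rewrite -val_eqE /=; have := ltn_ord j; lia.
  have /negbTE ij : i != j by rewrite -val_eqE /=; lia.
  by rewrite so_act_Nop ij scale0r /Nop dyv // dwv // !mulr0 !addr0 oppr0.
- rewrite so_act_Bop -Dop_Dop !Dv /Dop.
  by rewrite !(raddf0 (@dz C n)) !(raddf0 (@dy C n _)) !(raddf0 (@dw C n _))
    mulr0 !subr0.
- by rewrite so_act_Dop.
Qed.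

End HighestWeight.

(** * The two highest weight vectors *)

Section Vectors.
Variables (C : numFieldType) (m : nat).
Local Notation n := m.+1.
Local Notation l := (ord_max : 'I_n).
Local Notation poly := {mpoly C[n.*2.+1]}.
Implicit Types (i : 'I_n) (d q r e s t : nat).
Local Notation z := (zv C n).
Local Notation y i := (yv C i).
Local Notation w i := (wv C i).

Definition lmono e s t : 'X_{1..n.*2.+1} :=
  mono e (fun i => (i == l) * s)%N (fun i => (i == l) * t)%N.

Lemma mpolyX_lmono e s t :
  'X_[C, lmono e s t] = z ^+ e * (y l ^+ s * w l ^+ t).
Proof.
rewrite mpolyX_mono (bigD1 l) //= big1 ?mulr1 ?eqxx ?mul1n // => i /negbTE ->.
by rewrite mul0n !expr0 mulr1.
Qed.

Lemma lmono_dy i e s t : i != l -> dy i 'X_[C, lmono e s t] = 0.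
Proof. by move=> /negbTE il; rewrite polyE mderivX monoE il scale0r. Qed.

Lemma lmono_dw i e s t : i != l -> dw i 'X_[C, lmono e s t] = 0.
Proof. by move=> /negbTE il; rewrite polyE mderivX monoE il scale0r. Qed.

Lemma lmono_Nop e s t : Nop l l 'X_[C, lmono e s t] = (s + t)%:R * 'X_[lmono e
  s t].
Proof.
rewrite /Nop !polyE !XM_mderivX !monoE eqxx !mul1n -scalerDl -natrD.
by rewrite scaler_nat mulr_natl.
Qed.

Lemma lmono_grade e s t :
  grade (Tset n) (lmono e s t) = e%:Z + (t%:Z - s%:Z).
Proof.
rewrite gradeE monoE; congr (_ + _).
rewrite (bigD1 l) //= big1 ?addr0 => [|i /negbTE il];
  rewrite !monoE ?eqxx ?il ?mul1n //.
Qed.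

Lemma dydz_lmono r q : dy l (dz 'X_[C, lmono (2 * r.+1).+1 r.+1 (q - r.+1)]) =
  ((2 * r).+3 * r.+1)%:R *: 'X_[lmono (2 * r).+2 r (q - r.+1)].
Proof.
rewrite !polyE mderivX mderivZ mderivX scalerA -natrM !mnmBE !mnm1E !monoE !iE
  eqxx.
rewrite subn0 mul1n (_ : (2 * r.+1).+1 = (2 * r).+3); last by lia.
congr (_ *: 'X_[_]).
by apply: mnm_iP => [|i|i];
  rewrite !mnmBE !mnm1E !monoE !iE ?eqxx ?subn0 ?subn1 //=
  [l == i]eq_sym; case: (i == l); rewrite ?mul1n ?subn1.
Qed.

Lemma zdw_lmono r q : z * dw l 'X_[C, lmono (2 * r).+1 r (q - r)] =
  (q - r)%:R *: 'X_[lmono (2 * r).+2 r (q - r.+1)].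
Proof.
rewrite !polyE XM_mderivX_shift monoE eqxx mul1n; congr (_ *: 'X_[_]).
apply: mnm_iP => [|i|i]; rewrite mnmDE mnmBE !mnm1E !monoE !iE ?eqxx.
- by rewrite subn0 addn1.
- by rewrite subn0 addn0.
- by rewrite addn0 [l == i]eq_sym; case: (i == l);
  rewrite ?mul1n // subnS -subn1.
Qed.

(** Indexed by the power r = q - i of x_{n+1}, so that the degree in z is 2 r + 1 and the recursion
    goes upwards. *)
Definition f1_coef q r : C := q`!%:R / ((q - r)`! * r`! * double_fact (2 *
  r).+1)%:R.

Lemma double_fact_gt0 s : (0 < double_fact s)%N.
Proof.
have [N] := ubnP s; elim: N s => // N IHN [|[|s]] // lt_s.
by rewrite -[double_fact _]/(s.+2 * double_fact s)%N muln_gt0 /= IHN //; lia.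
Qed.

Lemma f1_coef_neq0 q r : f1_coef q r != 0.
Proof.
by rewrite mulf_neq0 ?invr_eq0 // pnatr_eq0 -lt0n ?muln_gt0 ?fact_gt0
  ?double_fact_gt0.
Qed.

(** The recursion imposed by D_n f = 0: dy dz of term r + 1 cancels z dw of term r. This is the
    origin of the double factorials. *)
Lemma f1_coefS q r : (r < q)%N ->
  f1_coef q r.+1 * ((2 * r).+3 * r.+1)%:R = f1_coef q r * (q - r)%:R.
Proof.
move=> lt_rq; rewrite /f1_coef mulrAC [RHS]mulrAC; apply/eqP.
rewrite eqr_div; try by rewrite pnatr_eq0 -lt0n !muln_gt0 !fact_gt0
  double_fact_gt0.
rewrite -!natrM (_ : (2 * r.+1).+1 = (2 * r).+3); last by lia.
rewrite -[double_fact _.+3]/((2 * r).+3 * double_fact (2 * r).+1)%N.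
rewrite (_ : (q - r = (q - r.+1).+1)%N); last by lia.
by rewrite !factS; apply/eqP; congr _%:R; ring.
Qed.

Lemma f1E q : f1 C n q =
  \sum_(r < q.+1) f1_coef q r *: 'X_[lmono (2 * r).+1 r (q - r)].
Proof.
have El : (l.+2 = n.+1)%N by [].
rewrite /f1 (reindex_inj rev_ord_inj) /=; apply: eq_bigr => r _.
have le_rq : (r <= q)%N by rewrite -ltnS.
rewrite subSS mpolyX_lmono !polyE mulrA -!ix_fold /f1_coef.
have -> : ix n (n + l.+2) = ix n n.*2.+1 by congr ix => /=; lia.
have -> : (1 + 2 * q - 2 * (q - r) = (2 * r).+1)%N by lia.
by have -> : (q - (q - r) = r)%N by lia.
Qed.

Lemma A_f1 q : A_ q.+1 (f1 C n q).
Proof.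
rewrite f1E; apply/A_onsupp; apply: onsupp_sum => r _ _; apply: onsuppZ.
by apply: onsuppX; rewrite lmono_grade; have := ltn_ord r; lia.
Qed.

Lemma dy_f1 q i : i != l -> dy i (f1 C n q) = 0.
Proof.
move=> il; rewrite f1E (raddf_sum (@dy C n i)) big1 //= => r _.
by rewrite linearZ /= lmono_dy // scaler0.
Qed.

Lemma dw_f1 q i : i != l -> dw i (f1 C n q) = 0.
Proof.
move=> il; rewrite f1E (raddf_sum (@dw C n i)) big1 //= => r _.
by rewrite linearZ /= lmono_dw // scaler0.
Qed.

Lemma Dop_f1 q i : Dop i (f1 C n q) = 0.
Proof.
have [->|il] := eqVneq i l; last first.
  by rewrite /Dop derC dy_f1 // dw_f1 // (raddf0 (@dz C n)) mulr0 subr0.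
rewrite /Dop f1E (raddf_sum (@dw C n l)) (raddf_sum (@dz C n)) (raddf_sum (@dy
  C n l)) /=.
apply/eqP; rewrite subr_eq0; apply/eqP.
(* The two sums match after a shift by one: the term r = 0 on the left contains no y, and the term r
   = q on the right no w. *)
rewrite mulr_sumr big_ord_recl [RHS]big_ord_recr /= !linearZ /=.
have -> : dy l (dz 'X_[C, lmono (2 * 0).+1 0 (q - 0)]) = 0.
  by rewrite derC dy.unlock mderivX monoE muln0 scale0r (raddf0 (@dz C n)).
rewrite -scalerAr zdw_lmono subnn scale0r !scaler0 add0r addr0;
  apply: eq_bigr => r _.
by rewrite !linearZ /= -scalerAr zdw_lmono dydz_lmono !scalerA f1_coefS.
Qed.

Lemma Nop_f1 q : Nop l l (f1 C n q) = q%:R * f1 C n q.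
Proof.
rewrite /Nop f1E (raddf_sum (@dw C n l)) (raddf_sum (@dy C n l)) /=.
rewrite !mulr_sumr -big_split; apply: eq_bigr => r _ /=.
have le_rq : (r <= q)%N by rewrite -ltnS.
rewrite !linearZ /= -!scalerAr -scalerDr -/(Nop l l _) lmono_Nop subnKC //.
Qed.

Lemma f1_neq0 q : f1 C n q != 0.
Proof.
have : (f1 C n q)@_(lmono 1 0 q) != 0; last by apply: contraNneq => ->;
  rewrite mcoeff0.
rewrite f1E big_ord_recl mcoeffD mcoeffZ mcoeffX muln0 subn0 eqxx mulr1.
rewrite (raddf_sum (mcoeff _)) big1 ?addr0 ?f1_coef_neq0 // => r _ /=.
rewrite mcoeffZ mcoeffX; case: eqP => [E|]; last by rewrite mulr0.
by have := congr1 (fun a : 'X_{1..n.*2.+1} => a (iz n)) E;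
  rewrite /= !monoE /bump; lia.
Qed.

(** Reverses [singular_dz]: each monomial has degree 2 r + 1 in z and r in y_n, so z dz^2 f = 2 y_n
    dy_n dz f. With sum_i y_i D_i f = 0 this gives z Delta f = 0, and z is cancelled. *)
Lemma Delta_f1 q : Delta (f1 C n q) = 0.
Proof.
have z0 : z != 0 by rewrite polyE -msupp_eq0 msuppX.
set f := f1 C n q.
have : \sum_(i < n) y i * Dop i f = 0 by rewrite big1 // => i _;
  rewrite Dop_f1 mulr0.
have -> : \sum_(i < n) y i * Dop i f = \sum_(i < n) y i * dy i (dz f) - z * Yop
  f.
  by rewrite YopE mulr_sumr -sumrB; apply: eq_bigr => i _; rewrite /Dop; ring.
rewrite (bigD1 l) //= big1 ?addr0 => [E|i il]; last first.
  by rewrite derC dy_f1 // (raddf0 (@dz C n)) mulr0.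
suff E2 : z * dz (dz f) = (y l * dy l (dz f)) *+ 2.
  apply: (mulfI z0); rewrite mulr0 Delta_Yop mulrBr E2.
  by rewrite mulrnAr -mulrnBl E mul0rn.
rewrite /f f1E !(raddf_sum (@dz C n)) (raddf_sum (@dy C n l)) /= !mulr_sumr
  -sumrMnl.
apply: eq_bigr => r _; rewrite !linearZ /= -!scalerAr scalerMnr; congr (_ *: _).
rewrite !polyE mderivX !mderivZ -!scalerAr scalerMnr; congr (_ *: _).
rewrite !XM_mderivX !mnmBE !mnm1E !monoE !iE !eqxx -scaler_nat scalerA;
  congr (_ *: _).
by rewrite -natrM subn0 mul1n subn1.
Qed.

Lemma H_f1 q : H_ q.+1 (f1 C n q).
Proof. by split; [apply: A_f1 | apply: Delta_f1]. Qed.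

Lemma lmono0_dz s : dz 'X_[C, lmono 0 s 0] = 0.
Proof. by rewrite polyE mderivX monoE scale0r. Qed.

Lemma lmono0_dw s i : dw i 'X_[C, lmono 0 s 0] = 0.
Proof. by rewrite polyE mderivX monoE muln0 scale0r. Qed.

Lemma H_lmono0 s : H_ (- s%:Z) 'X_[C, lmono 0 s 0].
Proof.
split; first by apply/A_onsupp; apply: onsuppX; rewrite lmono_grade; lia.
rewrite Delta_Yop lmono0_dz (raddf0 (@dz C n)) YopE big1 ?mul0rn ?subrr // => i
  _.
by rewrite lmono0_dw mulr0.
Qed.

Lemma highest_weight_f1 q (lam : 'M[C]_(n.*2.+1) -> C) :
  (forall h, lam h = q%:R * fund_weight m h - (2 * q.+1)%:R * fund_weight n h)
    ->
  is_highest_weight_vector (@so_act C n) (@cartan C n) (@so_plus C n) lam (f1 C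
    n q).
Proof.
move=> lamE; apply: (highest_weight_vector lamE); first exact: f1_neq0.
- exact: Dop_f1.
- exact: dy_f1.
- exact: dw_f1.
- exact: Nop_f1.
Qed.

Lemma highest_weight_lmono0 s (lam : 'M[C]_(n.*2.+1) -> C) :
  (forall h, lam h = s%:R * fund_weight m h - (2 * s.+1)%:R * fund_weight n h)
    ->
  is_highest_weight_vector (@so_act C n) (@cartan C n) (@so_plus C n) lam
    'X_[lmono 0 s 0].
Proof.
move=> lamE; apply: (highest_weight_vector lamE).
- by rewrite -msupp_eq0 msuppX.
- by move=> i; rewrite /Dop lmono0_dz lmono0_dw (raddf0 (@dy C n i)) mulr0
  subr0.
- by move=> i; apply: lmono_dy.
- by move=> i; apply: lmono_dw.
- by rewrite lmono_Nop addn0.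
Qed.

Lemma power_lmono0 s : 'X_(ix n n.+1) ^+ s = 'X_[C, lmono 0 s 0].
Proof.
rewrite mpolyX_lmono !expr0 mulr1 mul1r polyE -[iy _]ix_fold;
  congr ('X_(ix _ _) ^+ _).
Qed.

End Vectors.

(** * Translation to integer degrees, and the theorem over the complex numbers *)

Lemma absz_pred (k : int) : 0 < k -> `|k - 1|.+1 = k :> int.
Proof. lia. Qed.

Lemma opp_absz_opp (k : int) : k <= 0 -> - `|- k|%N%:Z = k.
Proof. lia. Qed.

(* F is kept apart from C because the two field structures of R[i] are
   convertible, but slow to unify inside a large goal. *)
Lemma harmonic_structure (C : numFieldType) (F : fieldType) (eqF : F = C)
    (n : nat) (hn : (1 <= n)%N) (k : int) :
  [/\ direct_sum_of (@A_ F n k) (@H_ F n k)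
        (image_of (@eta F n) (@A_ F n (k - 2))),
      0 < k ->
        is_irreducible (@so_act F n) (@so F n) (@H_ F n k) /\
        is_highest_weight_module (@so_act F n) (@so F n)
          (@cartan F n) (@so_plus F n) (@H_ F n k)
          (fun h => (k - 1)%:~R * fund_weight n.-1 h
                    - (2 * k)%:~R * fund_weight n h)
          (f1 F n `|(k - 1)%R|%N),
      k <= 0 ->
        is_irreducible (@so_act F n) (@so F n) (@H_ F n k) /\
        is_highest_weight_module (@so_act F n) (@so F n)
          (@cartan F n) (@so_plus F n) (@H_ F n k)
          (fun h => (- k)%:~R * fund_weight n.-1 h
                    + (2 * (k - 1))%:~R * fund_weight n h)
          ('X_(ix n n.+1) ^+ `|(- k)%R|%N) &
      is_basis (@basis_index n k) (@basis_poly F n) (@H_ F n k)].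
Proof.
rewrite {F}eqF.
case: n hn => // m _.
split=> [|/absz_pred dk|/opp_absz_opp ek|];
  [exact: A_decomposition | | | exact: H_basis].
- move: `|k - 1|%N dk => d dk; have Hf := @H_f1 C m d; rewrite dk in Hf.
  split; first by apply: (H_irreducible ord_max Hf); apply: f1_neq0.
  apply: (H_highest_weight ord_max Hf); apply: highest_weight_f1 => h.
  by rewrite -dk -[d.+1]addn1 PoszD addrK -PoszM.
- move: `|- k|%N ek => e ek; have Hf := @H_lmono0 C m e.
  rewrite ek in Hf; rewrite power_lmono0.
  split; first by apply: (H_irreducible ord_max Hf); rewrite -msupp_eq0 msuppX.
  apply: (H_highest_weight ord_max Hf); apply: highest_weight_lmono0 => h.
  rewrite -ek opprK -opprD mulrN -PoszD addn1 -PoszM.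
  by rewrite rmorphN mulNr.
Qed.

Local Open Scope complex_scope.

Theorem theorem4p2 (R : realType) (n : nat) (hn : (1 <= n)%N) (k : int) :
  [/\ direct_sum_of (@A_ R[i] n k) (@H_ R[i] n k)
        (image_of (@eta R[i] n) (@A_ R[i] n (k - 2))),
      0 < k ->
        is_irreducible (@so_act R[i] n) (@so R[i] n) (@H_ R[i] n k) /\
        is_highest_weight_module (@so_act R[i] n) (@so R[i] n)
          (@cartan R[i] n) (@so_plus R[i] n) (@H_ R[i] n k)
          (fun h => (k - 1)%:~R * fund_weight n.-1 h
                    - (2 * k)%:~R * fund_weight n h)
          (f1 R[i] n `|(k - 1)%R|%N),
      k <= 0 ->
        is_irreducible (@so_act R[i] n) (@so R[i] n) (@H_ R[i] n k) /\
        is_highest_weight_module (@so_act R[i] n) (@so R[i] n)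
          (@cartan R[i] n) (@so_plus R[i] n) (@H_ R[i] n k)
          (fun h => (- k)%:~R * fund_weight n.-1 h
                    + (2 * (k - 1))%:~R * fund_weight n h)
          ('X_(ix n n.+1) ^+ `|(- k)%R|%N) &
      is_basis (@basis_index n k) (@basis_poly R[i] n) (@H_ R[i] n k)].
Proof. exact: (@harmonic_structure (R[i] : numFieldType) R[i] (erefl _)). Qed.
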